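(* Assume the Model Assumption and fix $z\in\mathbb R$. Then $\mathbb E[\operatorname{proj}(\mathcal L_j(z)|C_1)^2]=0$ for all $j$, and $$\lim_{j\to\infty}\mathbb E[\operatorname{proj}(\mathcal L_j(z)|C_2)^2]=\pi^3\phi(z)^2M_a\frac{1}{\left(\int_{1/2}^2 b^2(x)x^{1-a}dx\right)^2}\int_{1/2}^2 b^4(x)x^{1-2a}\big(x^2M_a^{-1}+z^2-1\big)^2dx,$$ with $M_a=\int_{1/2}^2 b^2(x)x^{3-a}dx\big/\int_{1/2}^2 b^2(x)x^{1-a}dx$. This limit is nonzero for every $z$.
   Context: Let $\{f(x):x\in\mathbb S^2\}$ be a centered isotropic Gaussian random field, $f=\sum_{\ell\ge1}f_\ell$, $f_\ell=\sum_{m=-\ell}^{\ell}a_{\ell m}Y_{\ell m}$ ($Y_{\ell m}$ spherical harmonics, $a_{\ell m}$ Gaussian with $\mathbb E[a_{\ell m}\overline{a_{\ell'm'}}]=C_\ell\delta_\ell^{\ell'}\delta_m^{m'}$, $C_\ell>0$), so the $f_\ell$ are independent with $\mathbb E[f_\ell(x)f_\ell(y)]=C_\ell\frac{2\ell+1}{4\pi}P_\ell(\cos d(x,y))$. Let $b\ge0$ be $C^\infty$, supported in $[1/2,2]$, with $\sum_j b(\ell/2^j)^2=1$ for $\ell>2$. Put $\beta_j=\sum_{\ell=2^{j-1}}^{2^{j+1}}b(\ell/2^j)f_\ell$, $B_{2^j}=\sum_\ell b(\ell/2^j)^2C_\ell\frac{2\ell+1}{4\pi}$, $A_{2^j}=\frac1{B_{2^j}}\sum_\ell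 b(\ell/2^j)^2\frac{\ell(\ell+1)}2C_\ell\frac{2\ell+1}{4\pi}$, $\tilde\beta_j=\beta_j/\sqrt{B_{2^j}}$. $\partial_1,\partial_2$ are derivatives along an orthonormal tangent frame (in spherical coordinates $(\theta,\varphi)$: $\partial_1=\partial_\theta$, $\partial_2=(\sin\theta)^{-1}\partial_\varphi$); then $\mathbb E[(\partial_i\tilde\beta_j(x))^2]=A_{2^j}$ and we set $\tilde\partial_i\tilde\beta_j=\partial_i\tilde\beta_j/\sqrt{A_{2^j}}$. $\mathcal L_j(z)$ is the length of $\{x:\tilde\beta_j(x)=z\}$. $H_q$ are the (probabilists') Hermite polynomials, $\phi$ the standard Gaussian density, $\beta_\ell(z):=\phi(z)H_\ell(z)$, and $\alpha_{2n,2m}=\sqrt{\frac\pi2}\frac{(2n)!(2m)!}{n!m!}\frac{1}{2^{n+m}}\sum_{i=0}^{n+m}(-1)^{i+n+m}\binom{n+m}{i}\frac{(2i+1)!}{(i!)^2}\frac1{4^i}$, with $\alpha_{k,l}=0$ unless $k,l$ are both even. The $q$-th Wiener chaos component of $\mathcal L_j(z)$ (w.r.t. the Gaussian space generated by $f$) is $$\operatorname{proj}(\mathcal L_j(z)|C_q)=\sqrt{A_{2^j}}\sum_{u=0}^q\sum_{k=0}^u\frac{\alpha_{k,u-k}\beta_{q-u}(z)}{k!(u-k)!(q-u)!}\int_{\mathbb S^2}H_{q-u}(\tilde\beta_j(x))H_k(\tilde\partial_1\tilde\beta_j(x))H_{u-k}(\tilde\partial_2\tilde\beta_j(x))\,dx.$$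 Model Assumption: $C_\ell=\ell^{-a}G(\ell)$, $a>4$, $G=P/Q$ with $P,Q$ positive polynomials of equal degree, $G:=\lim_\ell G(\ell)>0$. *)

(* Defs.v *)
From HB Require Import structures.
From mathcomp Require Import all_boot all_order all_algebra.
From mathcomp Require Import all_classical all_reals all_analysis.
Set Implicit Arguments. Unset Strict Implicit. Unset Printing Implicit Defensive.
Import Order.TTheory GRing.Theory Num.Theory.
Import numFieldNormedType.Exports.
Local Open Scope classical_set_scope.
Local Open Scope ring_scope.

Section Defs.
Variable R : realType.

Definition smooth (f : R -> R) := forall n (x : R), derivable (derive1n n f) x 1.

(* probabilists' Hermite polynomials as functions *)
Fixpoint hermite_aux (n : nat) (x : R) : R * R :=
  match n with
  | 0 => (1, 0)
  | k.+1 => let (h, hp) := hermite_aux k x in (x * h - k%:R * hp, h)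
  end.
Definition hermite (n : nat) (x : R) : R := (hermite_aux n x).1.

Definition std_gauss (z : R) : R := expR (- z ^+ 2 / 2) / Num.sqrt (2 * pi).
Definition betaH (l : nat) (z : R) : R := std_gauss z * hermite l z.

Definition rodrigues (l n : nat) : {poly R} := derivn n (('X ^+ 2 - 1) ^+ l).

Definition legendre (l : nat) (t : R) : R :=
  (rodrigues l l).[t] / (2 ^+ l * (l`!)%:R).

(* associated Legendre function P_l^m (m >= 0, no Condon-Shortley phase)
   evaluated at cos theta, theta in [0, pi]:
   P_l^m(cos t) = (sin t)^m (d/dx)^m P_l (cos t) *)
Definition assoc_legendre_cos (l m : nat) (theta : R) : R :=
  (sin theta) ^+ m * (rodrigues l (l + m)).[cos theta] / (2 ^+ l * (l`!)%:R).

Definition harm_norm (l m : nat) : R :=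
  Num.sqrt ((2 * l%:R + 1) / (4 * pi) * (l - m)`!%:R / (l + m)`!%:R).

Definition sph_harm (l : nat) (m : int) (theta phi : R) : R :=
  let k := `|m|%N in
  harm_norm l k * assoc_legendre_cos l k theta *
  (if m == 0 then 1
   else if (0 < m)%R then Num.sqrt 2 * cos (k%:R * phi)
   else Num.sqrt 2 * sin (k%:R * phi)).

Definition harm_index (l : nat) (m : int) : Prop := (1 <= l)%N /\ (`|m| <= l)%N.

Definition f_comp {T : Type} (a : nat -> int -> T -> R) (l : nat) (w : T)
    (theta phi : R) : R :=
  \sum_(i < (l.*2).+1) a l (i%:Z - l%:Z) w * sph_harm l (i%:Z - l%:Z) theta phi.

Definition beta_j {T : Type} (b : R -> R) (a : nat -> int -> T -> R) (j : nat)
    (w : T) (theta phi : R) : R :=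
  \sum_((2 ^ j.-1)%N <= l < (2 ^ j.+1).+1) b (l%:R / 2 ^+ j) * f_comp a l w theta phi.

Definition Bcoef (C : nat -> R) (b : R -> R) (j : nat) : R :=
  \sum_((2 ^ j.-1)%N <= l < (2 ^ j.+1).+1)
     b (l%:R / 2 ^+ j) ^+ 2 * C l * (2 * l%:R + 1) / (4 * pi).

Definition Acoef (C : nat -> R) (b : R -> R) (j : nat) : R :=
  (Bcoef C b j)^-1 * \sum_((2 ^ j.-1)%N <= l < (2 ^ j.+1).+1)
     b (l%:R / 2 ^+ j) ^+ 2 * (l%:R * (l%:R + 1) / 2) * C l * (2 * l%:R + 1) / (4 * pi).

Definition S2int (g : R -> R -> R) : R :=
  \int[lebesgue_measure]_(theta in `[0, pi]%classic)
     ((\int[lebesgue_measure]_(phi in `[0, pi *+ 2]%classic) g theta phi) * sin theta).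

Definition alpha (k l : nat) : R :=
  if odd k || odd l then 0 else
  let n := k./2 in let m := l./2 in
  Num.sqrt (pi / 2) * ((n.*2)`!%:R * (m.*2)`!%:R / (n`!%:R * m`!%:R)) / 2 ^+ (n + m) *
  \sum_(i < (n + m).+1)
     (-1) ^+ (i + n + m) * 'C(n + m, i)%:R * ((i.*2).+1)`!%:R / ((i`!)%:R ^+ 2) / 4 ^+ i.

(* proj(L_j(z) | C_q) as given by the explicit chaos expansion *)
Definition chaos_proj {T : Type} (C : nat -> R) (b : R -> R)
    (a : nat -> int -> T -> R) (j q : nat) (z : R) (w : T) : R :=
  let A := Acoef C b j in
  let B := Bcoef C b j in
  let tb theta phi := beta_j b a j w theta phi / Num.sqrt B in
  let td1 theta phi := derive1 (fun t => tb t phi) theta / Num.sqrt A in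
  let td2 theta phi := derive1 (fun s => tb theta s) phi / sin theta / Num.sqrt A in
  Num.sqrt A * \sum_(u < q.+1) \sum_(k < u.+1)
    alpha k (u - k) * betaH (q - u) z / (k`!%:R * (u - k)`!%:R * (q - u)`!%:R) *
    S2int (fun theta phi => hermite (q - u) (tb theta phi) *
                            hermite k (td1 theta phi) * hermite (u - k) (td2 theta phi)).

Definition Cl (aexp : R) (Pp Qp : {poly R}) (l : nat) : R :=
  powR l%:R (- aexp) * (Pp.[l%:R] / Qp.[l%:R]).

Definition Ib (b : R -> R) (k : nat) (e : R) : R :=
  \int[lebesgue_measure]_(x in `[2^-1, 2]%classic) (b x ^+ k * powR x e).

Definition Ma (b : R -> R) (aexp : R) : R := Ib b 2 (3 - aexp) / Ib b 2 (1 - aexp).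

Definition limit_const (b : R -> R) (aexp z : R) : R :=
  pi ^+ 3 * std_gauss z ^+ 2 * Ma b aexp / (Ib b 2 (1 - aexp)) ^+ 2 *
  \int[lebesgue_measure]_(x in `[2^-1, 2]%classic)
     (b x ^+ 4 * powR x (1 - 2 * aexp) * (x ^+ 2 / Ma b aexp + z ^+ 2 - 1) ^+ 2).

End Defs.

Definition mutually_independent {R : realType} {d} {T : measurableType d}
    (P : probability T R) (D : nat -> int -> Prop) (X : nat -> int -> T -> R) : Prop :=
  forall (J : seq (nat * int)) (B : nat * int -> set R),
    uniq J -> (forall p, p \in J -> D p.1 p.2) -> (forall p, measurable (B p)) ->
    P (\bigcap_(p in [set` J]) (X p.1 p.2 @^-1` B p)) =
    (\prod_(p <- J) P (X p.1 p.2 @^-1` B p))%E.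

(* Main.v *)
(** Since the harmonics of degree l >= 1 integrate to 0, the first chaos vanishes
    identically.  In the second chaos only the coefficients alpha_{0,0}, alpha_{2,0} and
    alpha_{0,2} survive, and the last two are equal, so that the projection only involves
    the L^2 norms of the field and of its gradient; by Parseval and Green it equals
    K * sum_{l,m} g_l (a_{lm}^2 - C_l).  Independence and E a^4 = 3 C^2 turn its second moment into
    2 K^2 sum_l (2l+1) g_l^2 C_l^2.  With N = 2^j and x = l/N, the coefficients B, A and this sum are,
    up to explicit powers of N, Riemann sums of b^k x^e against sequences which converge
    because P/Q does.

    Orthogonality and Green's formula for the associated Legendre functions are reduced to
    the recursion J_{m+1} = (l (l+1) - m (m+1)) J_m for the polynomial integrals
    J_m = int_{-1}^1 (1-t^2)^m P_l^(m) P_l'^(m) dt, which comes from the Legendre equation.  The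
    left side being symmetric in (l, l'), J_m = 0 for l <> l'. *)

Require Import Defs.
From HB Require Import structures.
From mathcomp Require Import all_boot all_order all_algebra.
From mathcomp Require Import all_classical all_reals all_analysis.
From mathcomp Require Import measurable_realfun ring lra.
Set Implicit Arguments. Unset Strict Implicit. Unset Printing Implicit Defensive.
Import Order.TTheory GRing.Theory Num.Theory.
Import numFieldNormedType.Exports.
Local Open Scope classical_set_scope.
Local Open Scope ring_scope.

(** * Associated Legendre polynomials *)

Section PolyIntegral.
Variable R : realType.
Implicit Types p q : {poly R}.

(** The theta and phi components of the gradient are in general not diagonal in the harmonics when
    taken alone: entries with equal m and different l survive. Only the sum of the two forms is
    diagonal, with entries l (l+1), and alpha_{2,0} = alpha_{0,2} guarantees that the second chaos
    sees nothing but this sum. The constants -4 pi produced by the H_2 are exactly the means: the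
    2l+1 values of m rebuild the factor 2l+1 in A and B, which is why each a_{lm}^2 appears centred.
    The limit is positive because its integrand is b^4 x^(1-2a) times the square of x^2 / M_a + z^2
    - 1, which is strictly increasing for x > 0 and so cannot vanish on an interval where b is
    positive. Integrals over the sphere are computed with explicit primitives, so that finite sums
    of harmonics are handled by algebra. *)

Definition prim p : {poly R} := \poly_(i < (size p).+1) (p`_i.-1 / i%:R).

(** At [i = 0] the division is by zero and gives 0, so the primitive has no constant term. *)
Lemma coef_prim p i : (prim p)`_i = p`_i.-1 / i%:R.
Proof.
rewrite coef_poly; case: ltnP => //; case: i => // i.
by rewrite ltnS => /leq_sizeP -> //; rewrite mul0r.
Qed.

Lemma deriv_prim p : (prim p)^`() = p.
Proof.
by apply/polyP => i; rewrite coef_deriv coef_prim /= -[LHS]mulr_natr mulfVK.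
Qed.

(** Purely algebraic integral over [-1, 1]; [has_int_horner_cos] links it to the integral in the
    colatitude. *)
Definition pint p : R := (prim p).[1] - (prim p).[-1].

Lemma pintD p q : pint (p + q) = pint p + pint q.
Proof.
have -> : pint (p + q) = (prim p + prim q).[1] - (prim p + prim q).[-1].
  by congr (_.[_] - _.[_]); apply/polyP => i;
    rewrite coefD !coef_prim coefD mulrDl.
by rewrite !hornerD /pint; ring.
Qed.

Lemma pintZ c p : pint (c *: p) = c * pint p.
Proof.
have -> : pint (c *: p) = (c *: prim p).[1] - (c *: prim p).[-1].
  by congr (_.[_] - _.[_]); apply/polyP => i;
    rewrite coefZ !coef_prim coefZ mulrA.
by rewrite !hornerZ /pint mulrBr.
Qed.

Lemma pintN p : pint (- p) = - pint p.
Proof. by rewrite -scaleN1r pintZ mulN1r. Qed.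

Lemma pintB p q : pint (p - q) = pint p - pint q.
Proof. by rewrite pintD pintN. Qed.

Lemma pint_deriv p : pint p^`() = p.[1] - p.[-1].
Proof.
have -> : p = prim p^`() + (p`_0)%:P.
  apply/polyP => -[|i]; rewrite coefD coef_prim coefC /=.
    by rewrite invr0 mulr0 add0r.
  by rewrite coef_deriv addr0 -[p`_i.+1 *+ _]mulr_natr mulfK.
by rewrite derivD derivC addr0 deriv_prim !hornerE /pint; ring.
Qed.

Lemma deriv_sqrX_sub1 : ('X ^+ 2 - 1 : {poly R})^`() = 2 * 'X.
Proof. by rewrite derivB derivXn -[1]/(1%:P) derivC subr0 expr1 mulr_natl. Qed.

Lemma rodrigues_deriv l n : (rodrigues R l n)^`() = rodrigues R l n.+1.
Proof. by rewrite /rodrigues derivnS. Qed.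

(** For [y = ('X ^+ 2 - 1) ^+ l] one has [(X^2 - 1) y' = 2 l X y]. The recurrence is the derivative
    of order [n.+1] of this identity. *)
Lemma rodrigues_rec l n :
  ('X ^+ 2 - 1) * rodrigues R l n.+2
    + (2 * n.+1%:R - 2 * l%:R) * ('X * rodrigues R l n.+1)
    + (n.+1%:R * (n%:R - 2 * l%:R)) * rodrigues R l n = 0.
Proof.
have cE : forall (c : R) p, (c%:P * p)^`() = c%:P * p^`().
  by move=> c p; rewrite derivM derivC mul0r add0r.
elim: n => [|n IH].
  have base : ('X ^+ 2 - 1) * rodrigues R l 1 = 2 * l%:R * ('X * rodrigues R l 0).
    rewrite /rodrigues derivn1 derivn0 deriv_exp deriv_sqrX_sub1 -mulr_natr.
    case: l => [|l]; first by rewrite !(mulr0, mul0r).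
    by rewrite /= [_ ^+ l.+1]exprS; ring.
  have /(congr1 (fun p => p^`())) := base.
  have -> : 2 * l%:R = (2 * l%:R)%:P :> {poly R} by rewrite polyCM !polyC_natr.
  rewrite cE !derivM deriv_sqrX_sub1 derivX !rodrigues_deriv polyCM !polyC_natr.
  move/eqP; rewrite -subr_eq0 => /eqP <-; ring.
have /(congr1 (fun p => p^`())) := IH.
have -> : (2 * n.+1%:R - 2 * l%:R : {poly R}) = (2 * n.+1%:R - 2 * l%:R)%:P.
  by rewrite polyCB !polyCM !polyC_natr.
have -> : (n.+1%:R * (n%:R - 2 * l%:R) : {poly R}) = (n.+1%:R * (n%:R - 2 * l%:R))%:P.
  by rewrite polyCM polyCB !polyCM !polyC_natr.
rewrite !derivD !cE !derivM deriv_sqrX_sub1 derivX !rodrigues_deriv derivC.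
rewrite !polyCM !polyCB !polyCM !polyC_natr => <-.
rewrite -[n.+2]addn1 -[n.+1]addn1 !natrD; ring.
Qed.

(* [ulm l m] is [2 ^ l * l`!] times the m-th derivative of the Legendre polynomial P_l,
   and [wlm m] is the weight sin^(2m) in the variable t = cos theta. *)
Definition ulm (l m : nat) : {poly R} := rodrigues R l (l + m).
Definition wlm m : {poly R} := (1 - 'X ^+ 2) ^+ m.

Lemma ulm_deriv l m : (ulm l m)^`() = ulm l m.+1.
Proof. by rewrite /ulm rodrigues_deriv addnS. Qed.

Lemma wlm_deriv m : (wlm m.+1)^`() = - (2 * m.+1%:R) * ('X * wlm m).
Proof.
rewrite /wlm deriv_exp -(opprB ('X ^+ 2)) derivN deriv_sqrX_sub1 -mulr_natr /=.
by rewrite opprB; set w := _ ^+ m; ring.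
Qed.

(** Sturm-Liouville form of the Legendre equation differentiated m times. It is [- wlm m] times
    [rodrigues_rec] at [n = l + m], since (l+m+1)(l-m) = l(l+1) - m(m+1). *)
Lemma legendre_ode l m :
  (wlm m.+1 * ulm l m.+1)^`()
  = - ((l%:R * (l%:R + 1) - m%:R * (m%:R + 1)) *: (wlm m * ulm l m)).
Proof.
rewrite derivM ulm_deriv wlm_deriv -mul_polyC polyCB !polyCM !polyCD !polyC_natr.
have := rodrigues_rec l (l + m); rewrite -!addnS -/(ulm l m) -/(ulm l m.+1) -/(ulm l m.+2).
rewrite [wlm m.+1]exprS -/(wlm m).
rewrite -[m.+1]addn1 !natrD => E.
apply/eqP; rewrite -subr_eq0; apply/eqP.
transitivity (- wlm m * 0); last by rewrite mulr0.
rewrite -E; ring.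
Qed.

Definition Jlm l l' m : R := pint (wlm m * ulm l m * ulm l' m).

Lemma JlmC l l' m : Jlm l l' m = Jlm l' l m.
Proof. by rewrite /Jlm mulrAC. Qed.

Lemma JlmS l l' m :
  Jlm l l' m.+1 = (l%:R * (l%:R + 1) - m%:R * (m%:R + 1)) * Jlm l l' m.
Proof.
have := pint_deriv (wlm m.+1 * ulm l m.+1 * ulm l' m).
rewrite derivM legendre_ode ulm_deriv pintD -/(Jlm l l' m.+1).
rewrite mulNr pintN -scalerAl pintZ -/(Jlm l l' m).
(* The weight kills the boundary terms of the integration by parts, because its exponent is
   positive. *)
have w0 : forall x : R, x ^+ 2 = 1 -> (wlm m.+1).[x] = 0.
  by move=> x x2; rewrite /wlm !hornerE x2 subrr expr0n.
rewrite !hornerM !w0 ?sqrrN ?expr1n // !mul0r subrr => /eqP.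
by rewrite addrC subr_eq0 => /eqP.
Qed.

Lemma Jlm_neq l l' m : l != l' -> Jlm l l' m = 0.
Proof.
move=> ne; have := JlmS l l' m; rewrite JlmC JlmS JlmC => /eqP.
rewrite -subr_eq0 -mulrBl mulf_eq0 => /orP[|/eqP //].
have -> : l'%:R * (l'%:R + 1) - m%:R * (m%:R + 1) -
   (l%:R * (l%:R + 1) - m%:R * (m%:R + 1)) = (l'%:R - l%:R) * (l'%:R + l%:R + 1 : R).
  by ring.
rewrite mulf_eq0 subr_eq0 eqr_nat eq_sym (negbTE ne) /=.
by rewrite -!natrD -[1]/(1%:R) -natrD pnatr_eq0 addn1.
Qed.

(** A Beta integral. Its recursion comes from integrating the derivative of ['X * wlm l.+1], which
    vanishes at both ends. *)
Lemma pint_wlm l : pint (wlm l) * (l.*2.+1)`!%:R = 2 ^+ l.*2.+1 * l`!%:R ^+ 2.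
Proof.
elim: l => [|l IH].
  rewrite /wlm expr0 fact0 mulr1 expr1 expr1n mulr1.
  by rewrite -(derivX R) pint_deriv !hornerX opprK.
have E : (2 * l%:R + 3) * pint (wlm l.+1) = (2 * l%:R + 2) * pint (wlm l).
  have := pint_deriv ('X * wlm l.+1).
  have -> : ('X * wlm l.+1)^`() = (2 * l%:R + 3) *: wlm l.+1 - (2 * l%:R + 2) *: wlm l.
    rewrite derivM derivX wlm_deriv -!mul_polyC !polyCD !polyCM !polyC_natr.
    rewrite [wlm l.+1]exprS -/(wlm l) -[l.+1]addn1 !natrD; ring.
  rewrite pintB !pintZ !hornerM /wlm !hornerE /= sqrrN expr1n subrr expr0n /=.
  by rewrite !mulr0 subrr => /eqP; rewrite subr_eq0 => /eqP.
rewrite doubleS !factS !natrM.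
have -> : (l.*2.+3)%:R = 2 * l%:R + 3 :> R.
  by rewrite -[l.*2.+3]addn3 -mul2n natrD natrM.
have -> : (l.*2.+2)%:R = 2 * l%:R + 2 :> R.
  by rewrite -[l.*2.+2]addn2 -mul2n natrD natrM.
transitivity ((2 * l%:R + 3) * pint (wlm l.+1) * (2 * l%:R + 2) * (l.*2.+1)`!%:R).
  by rewrite factS natrM; ring.
rewrite E.
transitivity ((2 * l%:R + 2) ^+ 2 * (pint (wlm l) * (l.*2.+1)`!%:R)); first by ring.
rewrite IH -[l.+1]addn1 natrD !exprS; ring.
Qed.

(** Differentiating a monic polynomial of degree 2l exactly 2l times leaves the constant (2l)!. *)
Lemma ulm_top l : ulm l l = ((l.*2)`!%:R)%:P.
Proof.
rewrite /ulm /rodrigues addnn.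
have sz : size (('X ^+ 2 - 1 : {poly R}) ^+ l) = l.*2.+1.
  have s2 := @size_XnsubC R 2 1 isT.
  have := size_exp ('X^2 - 1%:P : {poly R}) l; rewrite s2 mul2n => E.
  rewrite -E /= prednK ?size_poly_gt0 ?expf_neq0 //.
  by rewrite -size_poly_gt0 s2.
have mon : (('X ^+ 2 - 1 : {poly R}) ^+ l)`_l.*2 = 1.
  have : ('X ^+ 2 - 1 : {poly R}) ^+ l \is monic by apply/monic_exp/monicXnsubC.
  by move/monicP; rewrite lead_coefE sz.
apply/polyP => i; rewrite coef_derivn coefC.
case: i => [|i] /=; first by rewrite addn0 mon ffactnn.
by rewrite nth_default ?mul0rn // sz addnS ltnS leq_addr.
Qed.

(** Descent from [m = l], where [ulm l l] is constant and the Beta integral applies; each step down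
    uses [JlmS] with its factor (l+m+1)(l-m). This gives the classical norm of the associated
    Legendre functions, up to the square of [2 ^ l * l!]. *)
Lemma Jlm_diag l m : (m <= l)%N ->
  Jlm l l m * (l - m)`!%:R * (2 * l%:R + 1)
    = (l + m)`!%:R * 2 ^+ l.*2.+1 * l`!%:R ^+ 2.
Proof.
move=> ml; rewrite -(subKn ml); move: (l - m)%N (leq_subr m l) => k {m ml}.
elim: k => [|k IH] kl.
  rewrite subn0 subnn fact0 mulr1 /Jlm ulm_top addnn.
  have -> : wlm l * (l.*2)`!%:R%:P * (l.*2)`!%:R%:P = ((l.*2)`!%:R ^+ 2) *: wlm l.
    by rewrite -mul_polyC rmorphXn /=; ring.
  rewrite pintZ -[RHS]mulrA -pint_wlm factS natrM.
  have -> : (l.*2.+1)%:R = 2 * l%:R + 1 :> R.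
    by rewrite -[l.*2.+1]addn1 -mul2n natrD natrM.
  by ring.
have := IH (ltnW kl).
have -> : (l - k = (l - k.+1).+1)%N by rewrite -subnSK.
rewrite JlmS subKn // -subSn // subSS subKn ?(ltnW kl) //.
set m := (l - k.+1)%N.
have lm : l = (k.+1 + m)%N by rewrite /m addnC subnK.
have -> : (l - k)%N = m.+1 by rewrite /m -subSn // subSS.
rewrite addnS factS natrM => E.
have nz : (l + m).+1%:R != 0 :> R by rewrite pnatr_eq0.
apply: (mulfI nz); rewrite !mulrA in E *; rewrite -E factS natrM.
rewrite -[(l + m).+1]addn1 !natrD lm natrD -[k.+1]addn1 natrD; ring.
Qed.

(* The Dirichlet form splits as [m (m + 1) J_m + J_(m + 1)] after integrating
   the cross term [- m t (1 - t^2)^m (u v)'] by parts. *)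
Lemma pint_grad l l' m :
  pint (wlm m * ((m.+1%:R *: ('X * ulm l m.+1) - (1 - 'X ^+ 2) * ulm l m.+2)
               * (m.+1%:R *: ('X * ulm l' m.+1) - (1 - 'X ^+ 2) * ulm l' m.+2)))
  + m.+1%:R ^+ 2 * pint (wlm m * ulm l m.+1 * ulm l' m.+1)
  = l%:R * (l%:R + 1) * Jlm l l' m.+1.
Proof.
rewrite -pintZ -pintD.
have -> : l%:R * (l%:R + 1) * Jlm l l' m.+1
   = m.+1%:R * (m.+1%:R + 1) * Jlm l l' m.+1 + Jlm l l' m.+2.
  by rewrite [Jlm l l' m.+2]JlmS; ring.
have := pint_deriv (- (m.+1%:R *: ('X * wlm m.+1 * (ulm l m.+1 * ulm l' m.+1)))).
have -> : (- (m.+1%:R *: ('X * wlm m.+1 * (ulm l m.+1 * ulm l' m.+1)))).[1]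
  - (- (m.+1%:R *: ('X * wlm m.+1 * (ulm l m.+1 * ulm l' m.+1)))).[-1] = 0.
  rewrite !(hornerN, hornerZ, hornerM) /wlm !horner_exp !hornerE /=.
  by rewrite sqrrN expr1n subrr !expr0n /= !(mulr0, mul0r) subrr.
move=> E; rewrite -[LHS]subr0 -E -pintB /Jlm -pintZ -pintD; congr pint.
rewrite derivN derivZ !derivM derivX wlm_deriv !ulm_deriv -!mul_polyC.
rewrite expr2 !polyCM !polyCD !polyC_natr.
rewrite [wlm m.+2]exprS -/(wlm m.+1) [wlm m.+1]exprS -/(wlm m) polyC1; ring.
Qed.

End PolyIntegral.

(** * Integrals with explicit primitives *)

Section HasInt.
Variable R : realType.
Implicit Types (f g : R -> R) (a b c v : R).

(* Asking for a primitive on the whole line makes the predicate stable under finite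
   sums without integrability side conditions. *)
Definition has_int f a b v := exists F : R -> R,
  [/\ forall x : R, is_derive x 1 F (f x), continuous f & F b - F a = v].

Lemma has_int_Rintegral f a b v : a < b -> has_int f a b v ->
  \int[lebesgue_measure]_(x in `[a, b]%classic) f x = v.
Proof.
move=> ab [F [dF cf <-]]; rewrite /Rintegral (@continuous_FTC2 _ f F) //.
- exact: continuous_subspaceT.
- have cF x : {for x, continuous F}.
    by apply: differentiable_continuous; apply/derivable1_diffP; case: (dF x).
  split; first by move=> x _; case: (dF x).
  + exact/cvg_at_right_filter/cF.
  + exact/cvg_at_left_filter/cF.
- by move=> x _; rewrite derive1E; exact: derive_val.
Qed.

Lemma has_int_eq f g a b v w :
  (forall x, f x = g x) -> v = w -> has_int f a b v -> has_int g a b w.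
Proof. by move=> /funext -> ->. Qed.

Lemma has_int0 a b : has_int (fun=> 0) a b 0.
Proof.
exists (fun=> 0); split; [|exact: cst_continuous|exact: subrr].
by move=> x; exact: is_derive_cst.
Qed.

Lemma has_intD f g a b v w : has_int f a b v -> has_int g a b w ->
  has_int (fun x => f x + g x) a b (v + w).
Proof.
move=> [F [dF cf <-]] [G [dG cg <-]]; exists (F + G); split.
- by move=> x; exact: is_deriveD.
- by move=> x; apply: cvgD; [exact: cf|exact: cg].
- by rewrite !fctE; ring.
Qed.

Lemma has_intZ f a b v c : has_int f a b v -> has_int (fun x => c * f x) a b (c * v).
Proof.
move=> [F [dF cf <-]]; exists (c *: F); split.
- by move=> x; apply: is_deriveZ.
- by move=> x; apply: cvgM; [exact: cvg_cst|exact: cf].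
- by rewrite !fctE /= -!mulrBr.
Qed.

Lemma has_int_cst c a b : has_int (fun=> c) a b (c * (b - a)).
Proof.
exists (fun x => c * x); split; last by rewrite mulrBr.
- move=> x; have := is_deriveZ c (is_derive_id x (1 : R)).
  by rewrite /GRing.scale /= mulr1.
- exact: cst_continuous.
Qed.

Lemma continuous_horner_cos (p : {poly R}) : continuous (fun x : R => p.[cos x]).
Proof.
move=> x; apply: (continuous_comp (f := cos) (g := fun t => p.[t])).
  exact: continuous_cos.
exact: continuous_horner.
Qed.

Lemma is_derive_horner_cos (p : {poly R}) (x : R) :
  is_derive x 1 (fun t => p.[cos t]) (- sin x * p^`().[cos x]).
Proof.
have := @is_derive1_comp R (fun t => p.[t]) cos x _ _ (is_derive_poly p (cos x)) (is_derive_cos x).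
by rewrite mulrC.
Qed.

(** Substitution t = cos x: the sign of the derivative - sin x restores the order of the bounds cos
    0 = 1 and cos pi = -1. *)
Lemma has_int_horner_cos (p : {poly R}) :
  has_int (fun x => p.[cos x] * sin x) 0 pi (pint p).
Proof.
exists (fun x => - (prim p).[cos x]); split.
- move=> x; have := is_deriveN (is_derive_horner_cos (prim p) x).
  by rewrite deriv_prim mulNr opprK mulrC.
- move=> x; apply: cvgM; [exact: continuous_horner_cos|exact: continuous_sin].
- by rewrite cospi cos0 opprK addrC.
Qed.

(** * Trigonometric integrals over a full period *)

Lemma cos_natM2pi k : cos (k%:R * (pi *+ 2)) = 1 :> R.
Proof.
elim: k => [|k IH]; first by rewrite mul0r cos0.
by rewrite -[k.+1]addn1 natrD mulrDl mul1r cosD2pi.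
Qed.

Lemma sin_natM2pi k : sin (k%:R * (pi *+ 2)) = 0 :> R.
Proof.
elim: k => [|k IH]; first by rewrite mul0r sin0.
by rewrite -[k.+1]addn1 natrD mulrDl mul1r sinD2pi.
Qed.

Lemma is_derive_mulc c (x : R) : is_derive x 1 (fun t => c * t) c.
Proof.
by have := is_deriveZ c (is_derive_id x (1 : R)); rewrite /GRing.scale /= mulr1.
Qed.

Lemma is_derive_cosM c (x : R) :
  is_derive x 1 (fun t => cos (c * t)) (- (c * sin (c * x))).
Proof.
have := @is_derive1_comp R cos (fun t => c * t) x _ _ (is_derive_cos _) (is_derive_mulc c x).
by rewrite mulNr mulrC.
Qed.

Lemma is_derive_sinM c (x : R) :
  is_derive x 1 (fun t => sin (c * t)) (c * cos (c * x)).
Proof.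
have := @is_derive1_comp R sin (fun t => c * t) x _ _ (is_derive_sin _) (is_derive_mulc c x).
by rewrite mulrC.
Qed.

Lemma continuous_cosM c : continuous (fun t : R => cos (c * t)).
Proof.
move=> x; apply: differentiable_continuous; apply/derivable1_diffP.
by case: (is_derive_cosM c x).
Qed.

Lemma continuous_sinM c : continuous (fun t : R => sin (c * t)).
Proof.
move=> x; apply: differentiable_continuous; apply/derivable1_diffP.
by case: (is_derive_sinM c x).
Qed.

Lemma has_int_cosM c : c != 0 -> sin (c * (pi *+ 2)) = 0 ->
  has_int (fun x => cos (c * x)) 0 (pi *+ 2) 0.
Proof.
move=> c0 s0; exists (fun x => c^-1 * sin (c * x)); split.
- move=> x; have := is_deriveZ c^-1 (is_derive_sinM c x).
  by rewrite /GRing.scale /= mulKf.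
- exact: continuous_cosM.
- by rewrite s0 !mulr0 sin0 mulr0 subrr.
Qed.

Lemma has_int_sinM c : cos (c * (pi *+ 2)) = 1 ->
  has_int (fun x => sin (c * x)) 0 (pi *+ 2) 0.
Proof.
move=> s0; have [->|c0] := eqVneq c 0.
  by apply: has_int_eq (has_int0 _ _) => // x; rewrite mul0r sin0.
exists (fun x => - c^-1 * cos (c * x)); split.
- move=> x; have := is_deriveZ (- c^-1) (is_derive_cosM c x).
  by rewrite /GRing.scale /= mulrNN mulKf.
- exact: continuous_sinM.
- by rewrite s0 !mulr0 cos0 subrr.
Qed.

Lemma has_int_cos_nat k : has_int (fun x => cos (k%:R * x)) 0 (pi *+ 2)
  (if k == 0%N then pi *+ 2 else 0).
Proof.
case: eqP => [->|/eqP k0]; last first.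
  by apply: has_int_cosM; rewrite ?pnatr_eq0 // sin_natM2pi.
apply: has_int_eq (has_int_cst 1 0 (pi *+ 2)) => [x|]; first by rewrite mul0r cos0.
by rewrite subr0 mul1r.
Qed.

Lemma has_int_cosB k n : has_int (fun x => cos ((k%:R - n%:R) * x)) 0 (pi *+ 2)
  (if k == n then pi *+ 2 else 0).
Proof.
case: eqP => [->|/eqP kn].
  apply: has_int_eq (has_int_cst 1 0 (pi *+ 2)) => [x|].
    by rewrite subrr mul0r cos0.
  by rewrite subr0 mul1r.
apply: has_int_cosM; first by rewrite subr_eq0 eqr_nat.
by rewrite mulrBl sinB !sin_natM2pi !cos_natM2pi; ring.
Qed.

(** Product-to-sum formula. As [0 < k], the frequency k + n is nonzero and its term integrates to 0,
    so only the frequency k - n can contribute. *)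
Lemma has_int_cos_cos k n : (0 < k)%N ->
  has_int (fun x => cos (k%:R * x) * cos (n%:R * x)) 0 (pi *+ 2)
  (if k == n then pi else 0).
Proof.
move=> k0; have := has_intZ 2^-1 (has_intD (has_int_cosB k n) (has_int_cos_nat (k + n))).
apply: has_int_eq => [x|].
  rewrite natrD mulrBl mulrDl cosB cosD; by field.
by rewrite addn_eq0 (gtn_eqF k0) addr0 -[pi *+ 2]mulr_natr; case: ifP => _; field.
Qed.

Lemma has_int_sin_sin k n : (0 < k)%N ->
  has_int (fun x => sin (k%:R * x) * sin (n%:R * x)) 0 (pi *+ 2)
  (if k == n then pi else 0).
Proof.
move=> k0.
have := has_intZ 2^-1 (has_intD (has_int_cosB k n) (has_intZ (-1) (has_int_cos_nat (k + n)))).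
apply: has_int_eq => [x|].
  rewrite natrD mulrBl mulrDl cosB cosD; by field.
by rewrite addn_eq0 (gtn_eqF k0) mulr0 addr0 -[pi *+ 2]mulr_natr; case: ifP => _; field.
Qed.

Lemma has_int_sin_cos k n :
  has_int (fun x => sin (k%:R * x) * cos (n%:R * x)) 0 (pi *+ 2) 0.
Proof.
have c1 : cos ((k%:R + n%:R) * (pi *+ 2)) = 1 :> R.
  by rewrite -natrD cos_natM2pi.
have c2 : cos ((k%:R - n%:R) * (pi *+ 2)) = 1 :> R.
  by rewrite mulrBl cosB !sin_natM2pi !cos_natM2pi; ring.
have := has_intZ 2^-1 (has_intD (has_int_sinM c1) (has_int_sinM c2)).
apply: has_int_eq => [x|]; last by rewrite addr0 mulr0.
rewrite mulrBl mulrDl sinB sinD; by field.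
Qed.

(** The azimuthal factor of [sph_harm]. The factor [Num.sqrt 2] gives every order the same squared
    norm 2 pi, including [m = 0]. *)
Definition azim (m : int) (x : R) : R :=
  if m == 0 then 1
  else if 0 < m then Num.sqrt 2 * cos (`|m|%N%:R * x)
  else Num.sqrt 2 * sin (`|m|%N%:R * x).

Definition dazim (m : int) (x : R) : R :=
  if m == 0 then 0
  else if 0 < m then - (Num.sqrt 2 * (`|m|%N%:R * sin (`|m|%N%:R * x)))
  else Num.sqrt 2 * (`|m|%N%:R * cos (`|m|%N%:R * x)).

Lemma is_derive_azim m (x : R) : is_derive x 1 (azim m) (dazim m x).
Proof.
rewrite /azim /dazim; case: ifP => _; first exact: is_derive_cst.
case: ifP => _.
  have := is_deriveZ (Num.sqrt 2) (is_derive_cosM `|m|%N%:R x).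
  by rewrite /GRing.scale /= mulrN.
exact: (is_deriveZ (Num.sqrt 2) (is_derive_sinM `|m|%N%:R x)).
Qed.

Lemma has_int_azim m : has_int (azim m) 0 (pi *+ 2) (if m == 0 then pi *+ 2 else 0).
Proof.
rewrite /azim; case: ifP => [_|/negbT m0].
  by apply: has_int_eq (has_int_cst 1 0 (pi *+ 2)) => //; rewrite subr0 mul1r.
case: (0 < m).
  have := has_intZ (Num.sqrt 2) (has_int_cos_nat `|m|%N).
  by rewrite absz_eq0 (negbTE m0) mulr0.
by have := has_intZ (Num.sqrt 2) (has_int_sinM (cos_natM2pi `|m|%N)); rewrite mulr0.
Qed.

Lemma sqrt2_mulM (x y : R) : 2 * (x * y) = Num.sqrt 2 * x * (Num.sqrt 2 * y).
Proof. by rewrite mulrACA -expr2 sqr_sqrtr. Qed.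

Lemma ltz0_natr (m : int) : m < 0 -> m%:~R = - `|m|%N%:R :> R.
Proof. by case: m => // k _; rewrite NegzE mulrNz. Qed.

Lemma absz_natr_sqr (m : int) : `|m|%N%:R ^+ 2 = m%:~R ^+ 2 :> R.
Proof. by case: m => k //; rewrite NegzE mulrNz sqrrN. Qed.

Lemma absz_eq_pos (m n : int) : 0 < m -> 0 < n -> (`|m|%N == `|n|%N) = (m == n).
Proof. by case: m n => [m|m] [n|n]. Qed.

Lemma absz_eq_neg (m n : int) : m < 0 -> n < 0 -> (`|m|%N == `|n|%N) = (m == n).
Proof. by case: m n => [m|m] [n|n]. Qed.

Lemma has_int_azimM m n : has_int (fun x => azim m x * azim n x) 0 (pi *+ 2)
  (if m == n then pi *+ 2 else 0).
Proof.
have [m0|m0] := eqVneq m 0.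
  apply: has_int_eq (has_int_azim n) => [x|]; last by rewrite m0 eq_sym.
  by rewrite m0 /azim eqxx mul1r.
have [n0|n0] := eqVneq n 0.
  apply: has_int_eq (has_int_azim m) => [x|]; last by rewrite n0.
  by rewrite n0 /azim eqxx mulr1.
have mp : (0 < `|m|)%N by rewrite absz_gt0.
rewrite /azim (negbTE m0) (negbTE n0).
case: (ltP 0 m) => hm; case: (ltP 0 n) => hn.
- apply: has_int_eq (has_intZ 2 (has_int_cos_cos `|n|%N mp)) => [x|].
    by rewrite -sqrt2_mulM.
  by rewrite absz_eq_pos //; case: ifP => _; rewrite ?mulr0 // mulr_natl.
- apply: has_int_eq (has_intZ 2 (has_int_sin_cos `|n|%N `|m|%N)) => [x|].
    by rewrite [RHS]mulrC -sqrt2_mulM.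
  by rewrite mulr0; case: eqP => // mn; move: hm hn; rewrite mn ltNge => /negbTE ->.
- apply: has_int_eq (has_intZ 2 (has_int_sin_cos `|m|%N `|n|%N)) => [x|].
    by rewrite -sqrt2_mulM.
  by rewrite mulr0; case: eqP => // mn; move: hn hm; rewrite mn ltNge => /negbTE ->.
- apply: has_int_eq (has_intZ 2 (has_int_sin_sin `|n|%N mp)) => [x|].
    by rewrite -sqrt2_mulM.
  rewrite absz_eq_neg ?lt_neqAle ?m0 ?n0 //.
  by case: ifP => _; rewrite ?mulr0 // mulr_natl.
Qed.

(** Differentiation exchanges sine and cosine, that is [m] and [- m]. Orthogonality of the
    derivatives is thereby inherited from [has_int_azimM]. *)
Lemma dazimE m x : dazim m x = - m%:~R * azim (- m) x.
Proof.
rewrite /dazim /azim oppr_eq0; case: eqP => [->|/eqP m0]; first by rewrite oppr0 mul0r.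
rewrite oppr_gt0 abszN; case: (ltP 0 m) => hm.
  rewrite lt_gtF // -[in RHS](gtz0_abs hm); ring.
have hm' : m < 0 by rewrite lt_neqAle m0.
by rewrite (ltz0_natr hm') hm'; ring.
Qed.

Lemma has_int_dazimM m n : has_int (fun x => dazim m x * dazim n x) 0 (pi *+ 2)
  (if m == n then `|m|%N%:R ^+ 2 * pi *+ 2 else 0).
Proof.
apply: has_int_eq (has_intZ (m%:~R * n%:~R) (has_int_azimM (- m) (- n))) => [x|].
  by rewrite !dazimE; ring.
rewrite eqr_opp; case: eqP => [->|_]; last by rewrite mulr0.
by rewrite absz_natr_sqr -mulrnAr expr2.
Qed.

End HasInt.

(** * Real spherical harmonics *)

Section SphericalHarmonics.
Variable R : realType.
Implicit Types (p q : nat * int).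

(** Absorbs the Rodrigues factor [2 ^ l * l!] that [ulm] leaves out. *)
Definition Ncst (l m : nat) : R := harm_norm R l m / (2 ^+ l * (l`!)%:R).

Definition Nlm (l m : nat) (x : R) : R := Ncst l m * (sin x ^+ m * (ulm R l m).[cos x]).

(** The power [sin x ^+ k] is factored out so that a product of two such derivatives is [wlm R k]
    times a polynomial in [cos x]. For [m = 0] there is no exponent m - 1, and the two factors
    [sin x] supply the weight [wlm R 1]. *)
Definition dNlm (l m : nat) (x : R) : R :=
  Ncst l m * (if m is k.+1 then
    sin x ^+ k * (m%:R * (cos x * (ulm R l m).[cos x]) - sin x ^+ 2 * (ulm R l m.+1).[cos x])
  else - sin x * (ulm R l 1).[cos x]).

Lemma sph_harmE l m x y : sph_harm l m x y = Nlm l `|m|%N x * azim m y :> R.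
Proof.
rewrite /sph_harm /assoc_legendre_cos /Nlm /Ncst; congr (_ * _).
by rewrite /ulm; ring.
Qed.

Lemma is_derive_Nlm l m (x : R) : is_derive x 1 (Nlm l m) (dNlm l m x).
Proof.
rewrite /Nlm /dNlm; apply: is_deriveZ.
have dh := is_derive_horner_cos (ulm R l m) x; rewrite ulm_deriv in dh.
case: m dh => [|k] dh.
  by under eq_fun do rewrite expr0 mul1r.
have := is_deriveM (is_deriveX k.+1 (is_derive_sin x)) dh.
rewrite /GRing.scale /=.
have -> : sin ^+ k.+1 = (fun t : R => sin t ^+ k.+1) by apply/funext => t; rewrite fctE.
move=> H; apply: is_derive_eq.
by rewrite exprS; ring.
Qed.

Lemma horner_wlm_cos m (x : R) : (wlm R m).[cos x] = sin x ^+ (2 * m).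
Proof. by rewrite /wlm horner_exp !hornerE -sin2cos2 -exprM. Qed.

Lemma has_int_Nlm l l' m :
  has_int (fun x => Nlm l m x * Nlm l' m x * sin x) 0 pi
    (Ncst l m * Ncst l' m * Jlm R l l' m).
Proof.
have := has_intZ (Ncst l m * Ncst l' m) (has_int_horner_cos (wlm R m * ulm R l m * ulm R l' m)).
apply: has_int_eq => // x.
by rewrite !hornerM horner_wlm_cos mul2n -addnn exprD /Nlm; ring.
Qed.

Definition dJlm (l l' m : nat) : R :=
  if m is k.+1 then
    pint (wlm R k * ((m%:R *: ('X * ulm R l m) - (1 - 'X ^+ 2) * ulm R l m.+1)
               * (m%:R *: ('X * ulm R l' m) - (1 - 'X ^+ 2) * ulm R l' m.+1)))
  else Jlm R l l' 1.

Lemma has_int_dNlm l l' m :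
  has_int (fun x => dNlm l m x * dNlm l' m x * sin x) 0 pi
    (Ncst l m * Ncst l' m * dJlm l l' m).
Proof.
case: m => [|k].
  have := has_intZ (Ncst l 0 * Ncst l' 0)
    (has_int_horner_cos (wlm R 1 * ulm R l 1 * ulm R l' 1)).
  apply: has_int_eq => // x.
  by rewrite !hornerM horner_wlm_cos /dNlm; ring.
have := has_intZ (Ncst l k.+1 * Ncst l' k.+1) (has_int_horner_cos
  (wlm R k * ((k.+1%:R *: ('X * ulm R l k.+1) - (1 - 'X ^+ 2) * ulm R l k.+2)
          * (k.+1%:R *: ('X * ulm R l' k.+1) - (1 - 'X ^+ 2) * ulm R l' k.+2)))).
apply: has_int_eq => // x.
rewrite hornerM horner_wlm_cos !(hornerM, hornerD, hornerN, hornerZ, hornerX, hornerXn).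
by rewrite -polyC1 hornerC -sin2cos2 mul2n -addnn exprD /dNlm; ring.
Qed.

(** The term m^2 / sin^2 of the Dirichlet form: dividing by 1 - t^2 lowers the exponent of the
    weight from m to m - 1. *)
Definition sJlm (l l' m : nat) : R :=
  if m is k.+1 then m%:R ^+ 2 * pint (wlm R k * ulm R l m * ulm R l' m) else 0.

(* At the poles [sin x = 0] and both sides vanish, whatever the junk value of [/ sin x]. *)
Lemma has_int_Nlm_sin l l' m :
  has_int (fun x => m%:R ^+ 2 * (Nlm l m x / sin x * (Nlm l' m x / sin x)) * sin x) 0 pi
    (Ncst l m * Ncst l' m * sJlm l l' m).
Proof.
case: m => [|k].
  rewrite mulr0; apply: has_int_eq (has_int0 _ _) => // x.
  by rewrite expr2 !mul0r.
have := has_intZ (Ncst l k.+1 * Ncst l' k.+1 * k.+1%:R ^+ 2)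
  (has_int_horner_cos (wlm R k * ulm R l k.+1 * ulm R l' k.+1)).
apply: has_int_eq => [x|]; last by rewrite /sJlm; ring.
rewrite !hornerM horner_wlm_cos /Nlm.
have [->|s0] := eqVneq (sin x) 0; first by rewrite !mulr0.
by rewrite mul2n -addnn exprD [_ ^+ k.+1]exprS; field.
Qed.

(** Green's formula at a fixed azimuthal order. The right side vanishes for [l != l'], although the
    two terms on the left need not. *)
Lemma dJlm_sJlm l l' m : dJlm l l' m + sJlm l l' m = l%:R * (l%:R + 1) * Jlm R l l' m.
Proof.
case: m => [|k]; last exact: pint_grad.
by rewrite addr0 /dJlm JlmS; ring.
Qed.

(** The factor 2 pi is the squared norm of [azim], so this is the unit norm of the real spherical
    harmonics. *)
Lemma Ncst_Jlm l m : (m <= l)%N -> pi *+ 2 * (Ncst l m ^+ 2 * Jlm R l l m) = 1.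
Proof.
move=> ml; have := Jlm_diag R ml.
have p0 : (pi : R) != 0 by rewrite gt_eqF // pi_gt0.
have f0 n : n`!%:R != 0 :> R by rewrite pnatr_eq0 -lt0n fact_gt0.
have l0 : 2 * l%:R + 1 != 0 :> R by rewrite -natrM -[1]/(1%:R) -natrD pnatr_eq0 addn1.
rewrite /Ncst /harm_norm expr_div_n sqr_sqrtr; last first.
  by rewrite !mulr_ge0 ?invr_ge0 ?addr_ge0 ?mulr_ge0 ?pi_ge0 ?ler0n.
rewrite exprS -mul2n exprM.
have -> : (2 ^+ 2 : R) ^+ l = (2 ^+ l) ^+ 2 by rewrite -!exprM mulnC.
have t0 : 2 ^+ l != 0 :> R by rewrite expf_neq0.
move=> E; have -> : Jlm R l l m = (l + m)`!%:R * (2 * (2 ^+ l) ^+ 2) * l`!%:R ^+ 2 /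
    ((l - m)`!%:R * (2 * l%:R + 1)).
  by rewrite -E; field; rewrite f0 l0.
move: (2 ^+ l) t0 (pi : R) p0 => t t0 w w0.
by rewrite -mulr_natl; field; rewrite ?f0 ?t0 ?l0 ?w0.
Qed.

(** Two-variable analogue of [has_int], with [h] the inner integral as a function of the colatitude.
    It is linear in [g] without further conditions and determines [S2int g]. *)
Definition isS2 (g : R -> R -> R) (v : R) := exists h : R -> R,
  (forall x, has_int (g x) 0 (pi *+ 2) (h x)) /\
  has_int (fun x => h x * sin x) 0 pi v.

Lemma isS2_S2int g v : isS2 g v -> S2int g = v.
Proof.
move=> [h [gh hv]]; rewrite /S2int.
have <- := has_int_Rintegral (pi_gt0 R) hv.
apply: eq_Rintegral => x _; congr (_ * _).
by apply: has_int_Rintegral => //; rewrite mulrn_wgt0 // pi_gt0.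
Qed.

Lemma isS2_eq g g' v v' : (forall x y, g x y = g' x y) -> v = v' -> isS2 g v -> isS2 g' v'.
Proof. by move=> gg' ->; have -> : g = g' by apply/funext => x; apply/funext. Qed.

Lemma isS2_cst c : isS2 (fun _ _ => c) (4 * pi * c).
Proof.
exists (fun=> c * (pi *+ 2)); split.
  by move=> x; have := has_int_cst c 0 (pi *+ 2); rewrite subr0.
have := has_intZ (c * (pi *+ 2)) (has_int_horner_cos (1 : {poly R})).
apply: has_int_eq => [x|]; first by rewrite hornerC mul1r.
by rewrite -(derivX R) pint_deriv !hornerX -[pi *+ 2]mulr_natr; ring.
Qed.

Lemma isS2D f g v w : isS2 f v -> isS2 g w -> isS2 (fun x y => f x y + g x y) (v + w).
Proof.
move=> [hf [fhf hfv]] [hg [ghg hgw]]; exists (fun x => hf x + hg x); split.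
  by move=> x; exact: has_intD.
by apply: has_int_eq (has_intD hfv hgw) => // x; rewrite mulrDl.
Qed.

Lemma isS2Z c f v : isS2 f v -> isS2 (fun x y => c * f x y) (c * v).
Proof.
move=> [h [fh hv]]; exists (fun x => c * h x); split.
  by move=> x; exact: has_intZ.
by apply: has_int_eq (has_intZ c hv) => // x; rewrite mulrA.
Qed.

Lemma isS2_sum (I : eqType) (s : seq I) (f : I -> R -> R -> R) (v : I -> R) :
  (forall i, i \in s -> isS2 (f i) (v i)) ->
  isS2 (fun x y => \sum_(i <- s) f i x y) (\sum_(i <- s) v i).
Proof.
elim: s => [|i s IH] H.
  apply: isS2_eq (isS2_cst 0) => [x y|]; first by rewrite big_nil.
  by rewrite big_nil mulr0.
have Hs : forall j, j \in s -> isS2 (f j) (v j).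
  by move=> j js; apply: H; rewrite inE js orbT.
have Hi : isS2 (f i) (v i) by apply: H; rewrite inE eqxx.
by apply: isS2_eq (isS2D Hi (IH Hs)) => [x y|]; rewrite big_cons.
Qed.

Lemma isS2_prod (f g : R -> R) v w : has_int g 0 (pi *+ 2) w ->
  has_int (fun x => w * f x * sin x) 0 pi v -> isS2 (fun x y => f x * g y) v.
Proof.
move=> hg hf; exists (fun x => w * f x); split => // x.
by apply: has_int_eq (has_intZ (f x) hg) => //; rewrite mulrC.
Qed.

Lemma isS2_prod0 (f g : R -> R) : has_int g 0 (pi *+ 2) 0 -> isS2 (fun x y => f x * g y) 0.
Proof.
move=> hg; apply: isS2_prod hg _.
by apply: has_int_eq (has_int0 _ _) => // x; rewrite !mul0r.
Qed.

(* [Ythp] and [Yphp] are the components of the gradient of [Yp] in the frame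
   (d_theta, (sin theta)^-1 d_phi). *)
Definition Yp p x y : R := Nlm p.1 `|p.2|%N x * azim p.2 y.
Definition Ythp p x y : R := dNlm p.1 `|p.2|%N x * azim p.2 y.
Definition Yphp p x y : R := Nlm p.1 `|p.2|%N x / sin x * dazim p.2 y.

Definition valid p := (0 < p.1)%N && (`|p.2|%N <= p.1)%N.

Lemma isS2_Yp p : valid p -> isS2 (Yp p) 0.
Proof.
case: p => l m /andP[/= l0 ml].
have := has_int_azim R m; case: eqP => [->|_] h; last exact: isS2_prod0.
apply: isS2_prod h _.
have := has_intZ (pi *+ 2 * Ncst l 0) (has_int_horner_cos (ulm R l 0)).
apply: has_int_eq => [x|]; first by rewrite /Nlm expr0; ring.
(* Since [ulm R 0 0] is 1, the mean of a zonal harmonic is its pairing with the harmonic of degree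
   0. *)
have -> : pint (ulm R l 0) = Jlm R l 0 0.
  by rewrite /Jlm /wlm expr0 mul1r ulm_top mulr1.
by rewrite Jlm_neq ?mulr0 // -lt0n.
Qed.

Lemma isS2_Yp_Yp p q : valid p -> valid q ->
  isS2 (fun x y => Yp p x y * Yp q x y) (if p == q then 1 else 0).
Proof.
case: p q => [l m] [l' m'] /andP[/= l0 ml] /andP[/= l0' ml'].
apply: (@isS2_eq (fun x y => (Nlm l `|m|%N x * Nlm l' `|m'|%N x) * (azim m y * azim m' y)))
  => [x y|//|]; first by rewrite /Yp mulrACA.
rewrite xpair_eqE.
have := has_int_azimM R m m'; case: eqP => [<-|_] h; last first.
  by rewrite andbF; exact: isS2_prod0.
apply: isS2_prod h _; rewrite andbT.
apply: has_int_eq (has_intZ (pi *+ 2) (has_int_Nlm l l' `|m|%N)) => [x|].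
  by rewrite !mulrA.
case: eqP => [<-|/eqP ll']; last by rewrite Jlm_neq // !mulr0.
by rewrite -expr2 Ncst_Jlm.
Qed.

(** [gth] and [gph] are the Gram matrices of the two gradient components. Different orders m are
    orthogonal, but entries with different degrees remain. *)
Definition gth p q : R :=
  if p.2 == q.2 then
    pi *+ 2 * (Ncst p.1 `|p.2|%N * Ncst q.1 `|p.2|%N * dJlm p.1 q.1 `|p.2|%N) else 0.
Definition gph p q : R :=
  if p.2 == q.2 then
    pi *+ 2 * (Ncst p.1 `|p.2|%N * Ncst q.1 `|p.2|%N * sJlm p.1 q.1 `|p.2|%N) else 0.

Lemma isS2_Ythp p q : isS2 (fun x y => Ythp p x y * Ythp q x y) (gth p q).
Proof.
case: p q => [l m] [l' m']; rewrite /gth /=.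
apply: (@isS2_eq (fun x y => (dNlm l `|m|%N x * dNlm l' `|m'|%N x) * (azim m y * azim m' y)))
  => [x y|//|]; first by rewrite /Ythp mulrACA.
have := has_int_azimM R m m'; case: eqP => [<-|_] h; last exact: isS2_prod0.
apply: isS2_prod h _.
apply: has_int_eq (has_intZ (pi *+ 2) (has_int_dNlm l l' `|m|%N)) => // x.
by rewrite !mulrA.
Qed.

Lemma isS2_Yphp p q : isS2 (fun x y => Yphp p x y * Yphp q x y) (gph p q).
Proof.
case: p q => [l m] [l' m']; rewrite /gph /=.
apply: (@isS2_eq (fun x y => (Nlm l `|m|%N x / sin x * (Nlm l' `|m'|%N x / sin x))
  * (dazim m y * dazim m' y))) => [x y|//|]; first by rewrite /Yphp mulrACA.
have := has_int_dazimM R m m'; case: eqP => [<-|_] h; last exact: isS2_prod0.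
apply: isS2_prod h _.
apply: has_int_eq (has_intZ (pi *+ 2) (has_int_Nlm_sin l l' `|m|%N)) => // x.
by rewrite -mulrnAr; ring.
Qed.

(** Entries with different degrees cancel between the two components, which leaves the eigenvalue of
    minus the Laplacian on the diagonal. *)
Lemma gth_gph p q : valid p -> valid q ->
  gth p q + gph p q = if p == q then p.1%:R * (p.1%:R + 1) else 0.
Proof.
case: p q => [l m] [l' m'] /andP[/= l0 ml] _; rewrite /gth /gph xpair_eqE /=.
case: eqP => [_|_]; last by rewrite andbF addr0.
rewrite andbT -mulrDr -mulrDr dJlm_sJlm.
case: eqP => [<-|/eqP ll']; last by rewrite Jlm_neq // !mulr0.
transitivity (l%:R * (l%:R + 1) * (pi *+ 2 * (Ncst l `|m|%N ^+ 2 * Jlm R l l `|m|%N))).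
  by ring.
by rewrite Ncst_Jlm // mulr1.
Qed.

Lemma isS2_sqr_sum (s : seq (nat * int)) (c : nat * int -> R)
    (f : nat * int -> R -> R -> R) (v : nat * int -> nat * int -> R) :
  (forall p q, p \in s -> q \in s -> isS2 (fun x y => f p x y * f q x y) (v p q)) ->
  isS2 (fun x y => (\sum_(p <- s) c p * f p x y) ^+ 2)
       (\sum_(p <- s) \sum_(q <- s) c p * c q * v p q).
Proof.
move=> H.
apply: (@isS2_eq (fun x y => \sum_(p <- s) \sum_(q <- s) c p * c q * (f p x y * f q x y))
  _ _ _ _ erefl).
  move=> x y; rewrite expr2 mulr_suml; apply: eq_bigr => p _.
  by rewrite mulr_sumr; apply: eq_bigr => q _; ring.
apply: isS2_sum => p ps.
apply: (@isS2_sum _ s (fun q x y => c p * c q * (f p x y * f q x y))) => q qs.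
by apply: isS2Z; exact: H.
Qed.

Lemma sum_diag (s : seq (nat * int)) (F : nat * int -> nat * int -> R) : uniq s ->
  (forall p q, p \in s -> q \in s -> p != q -> F p q = 0) ->
  \sum_(p <- s) \sum_(q <- s) F p q = \sum_(p <- s) F p p.
Proof.
move=> us F0; rewrite big_seq [RHS]big_seq; apply: eq_bigr => p ps.
rewrite (bigD1_seq p) //= big_seq_cond big1 ?addr0 // => q /andP[qs qp].
by rewrite F0 // eq_sym.
Qed.

Section Parseval.
Variables (s : seq (nat * int)) (us : uniq s) (vs : all valid s) (c : nat * int -> R).

Lemma isS2_sum_Yp : isS2 (fun x y => \sum_(p <- s) c p * Yp p x y) 0.
Proof.
have := @isS2_sum _ s (fun p x y => c p * Yp p x y) (fun=> 0).
rewrite big1 //; apply => p ps.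
by apply: isS2_eq (isS2Z (c p) (isS2_Yp (allP vs p ps))) => //; rewrite mulr0.
Qed.

Lemma isS2_sqr_Yp :
  isS2 (fun x y => (\sum_(p <- s) c p * Yp p x y) ^+ 2) (\sum_(p <- s) c p ^+ 2).
Proof.
have H p q : p \in s -> q \in s ->
    isS2 (fun x y => Yp p x y * Yp q x y) (if p == q then 1 else 0).
  by move=> ps qs; apply: isS2_Yp_Yp; exact: (allP vs).
apply: isS2_eq (isS2_sqr_sum c H) => //.
rewrite sum_diag // => [|p q _ _ /negbTE ->]; last by rewrite mulr0.
by apply: eq_bigr => p _; rewrite eqxx mulr1 expr2.
Qed.

Definition Vth : R := \sum_(p <- s) \sum_(q <- s) c p * c q * gth p q.
Definition Vph : R := \sum_(p <- s) \sum_(q <- s) c p * c q * gph p q.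

Lemma isS2_sqr_Ythp : isS2 (fun x y => (\sum_(p <- s) c p * Ythp p x y) ^+ 2) Vth.
Proof. by apply: isS2_sqr_sum => p q _ _; exact: isS2_Ythp. Qed.

Lemma isS2_sqr_Yphp : isS2 (fun x y => (\sum_(p <- s) c p * Yphp p x y) ^+ 2) Vph.
Proof. by apply: isS2_sqr_sum => p q _ _; exact: isS2_Yphp. Qed.

Lemma Vth_Vph : Vth + Vph = \sum_(p <- s) p.1%:R * (p.1%:R + 1) * c p ^+ 2.
Proof.
rewrite /Vth /Vph -big_split /=.
under eq_bigr do rewrite -big_split /=.
have E p q : p \in s -> q \in s -> c p * c q * gth p q + c p * c q * gph p q
    = c p * c q * (if p == q then p.1%:R * (p.1%:R + 1) else 0).
  by move=> ps qs; rewrite -mulrDr gth_gph //; exact: (allP vs).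
rewrite sum_diag // => [|p q ps qs pq]; last by rewrite E // (negbTE pq) mulr0.
rewrite big_seq [RHS]big_seq; apply: eq_bigr => p ps.
by rewrite E // eqxx expr2 mulrC.
Qed.

End Parseval.
End SphericalHarmonics.

(** * First and second chaos projections *)

Section ChaosProjections.
Variables (R : realType) (T : Type) (C : nat -> R) (b : R -> R) (a : nat -> int -> T -> R).
Implicit Types (p q : nat * int) (j : nat) (w : T).

Definition lwin j : seq nat := index_iota (2 ^ j.-1) (2 ^ j.+1).+1.

Definition hidx j : seq (nat * int) :=
  [seq (l, i%:Z - l%:Z) | l <- lwin j, i <- iota 0 (l.*2).+1].

Lemma big_hidx j (F : nat * int -> R) :
  \sum_(p <- hidx j) F p =
  \sum_(l <- lwin j) \sum_(i < (l.*2).+1) F (l, i%:Z - l%:Z).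
Proof.
rewrite /hidx big_allpairs_dep; apply: eq_bigr => l _.
by rewrite -(big_mkord xpredT (fun i : nat => F (l, i%:Z - l%:Z))) /index_iota subn0.
Qed.

Lemma big_hidx1 j (h : nat -> R) :
  \sum_(p <- hidx j) h p.1 = \sum_(l <- lwin j) (2 * l%:R + 1) * h l.
Proof.
rewrite big_hidx; apply: eq_bigr => l _ /=.
rewrite sumr_const card_ord -[LHS]mulr_natl -[l.*2.+1]addn1; congr (_ * _).
by rewrite natrD -mul2n natrM.
Qed.

Lemma uniq_hidx j : uniq (hidx j).
Proof.
apply: allpairs_uniq_dep; first exact: iota_uniq.
  by move=> l _; exact: iota_uniq.
move=> [l i] [l' i'] _ _ /= [<- E]; congr existT.
by move/addIr: E => [].
Qed.

Lemma hidx_valid j : all valid (hidx j).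
Proof.
apply/allP => _ /allpairsPdep[l [i [ll ii ->]]]; apply/andP; split => /=.
  (* The window starts at [2 ^ j.-1], which is at least 1 even for [j = 0], so the degree 0 never
     occurs. *)
  by move: ll; rewrite mem_index_iota => /andP[+ _]; apply: leq_trans; rewrite expn_gt0.
move: ii; rewrite mem_iota add0n /= ltnS => il.
case: (leqP l i) => li.
  by rewrite subzn // absz_nat leq_subLR addnn.
by rewrite -abszN opprB subzn ?absz_nat ?leq_subr // ltnW.
Qed.

Lemma beta_jE j w x y :
  beta_j b a j w x y = \sum_(p <- hidx j) b (p.1%:R / 2 ^+ j) * a p.1 p.2 w * Yp p x y.
Proof.
rewrite big_hidx; apply: eq_bigr => l _.
rewrite /f_comp mulr_sumr; apply: eq_bigr => i _.
by rewrite sph_harmE /Yp /= !mulrA.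
Qed.

Definition ncoef j w p : R := b (p.1%:R / 2 ^+ j) * a p.1 p.2 w / Num.sqrt (Bcoef C b j).

Lemma beta_normE j w x y : beta_j b a j w x y / Num.sqrt (Bcoef C b j)
  = \sum_(p <- hidx j) ncoef j w p * Yp p x y.
Proof.
rewrite beta_jE mulr_suml; apply: eq_bigr => p _.
by rewrite /ncoef; ring.
Qed.

Lemma derive1_sum (s : seq (nat * int)) (c : nat * int -> R)
    (f df : nat * int -> R -> R) (x : R) :
  (forall p, is_derive x 1 (f p) (df p x)) ->
  derive1 (fun t => \sum_(p <- s) c p * f p t) x = \sum_(p <- s) c p * df p x.
Proof.
move=> H; suff E : is_derive x 1 (fun t => \sum_(p <- s) c p * f p t)
    (\sum_(p <- s) c p * df p x) by rewrite derive1E derive_val.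
elim: s => [|p s IH].
  by under eq_fun do rewrite big_nil; rewrite big_nil; exact: is_derive_cst.
under eq_fun do rewrite big_cons; rewrite big_cons.
apply: is_deriveD; exact: is_deriveZ.
Qed.

Lemma derive1_beta_th j w x y :
  derive1 (fun t => beta_j b a j w t y / Num.sqrt (Bcoef C b j)) x
  = \sum_(p <- hidx j) ncoef j w p * Ythp p x y.
Proof.
under eq_fun do rewrite beta_normE.
apply: (@derive1_sum _ _ (fun p t => Yp p t y) (fun p t => Ythp p t y)) => p.
rewrite /Yp /Ythp; under eq_fun do rewrite mulrC; rewrite mulrC.
exact: (is_deriveZ (azim p.2 y) (is_derive_Nlm p.1 `|p.2|%N x)).
Qed.

Lemma derive1_beta_ph j w x y :
  derive1 (fun t => beta_j b a j w x t / Num.sqrt (Bcoef C b j)) y / sin x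
  = \sum_(p <- hidx j) ncoef j w p * Yphp p x y.
Proof.
under eq_fun do rewrite beta_normE.
have dY p : is_derive y 1 (fun t => Yp p x t) (Nlm p.1 `|p.2|%N x * dazim p.2 y).
  exact: (is_deriveZ (Nlm p.1 `|p.2|%N x) (is_derive_azim p.2 y)).
rewrite (@derive1_sum _ _ (fun p t => Yp p x t)
  (fun p t => Nlm p.1 `|p.2|%N x * dazim p.2 t) _ dY).
  by rewrite mulr_suml; apply: eq_bigr => p _; rewrite /Yphp; ring.
Qed.

(** * Hermite polynomials and chaos coefficients of order at most two *)

Lemma hermite0E (x : R) : hermite 0 x = 1. Proof. by []. Qed.

Lemma hermite1E (x : R) : hermite 1 x = x.
Proof. by rewrite /hermite /= mulr1 mul0r subr0. Qed.

Lemma hermite2E (x : R) : hermite 2 x = x ^+ 2 - 1.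
Proof. by rewrite /hermite /= !mulr1 mul0r subr0 expr2. Qed.

Lemma alpha00 : alpha R 0 0 = Num.sqrt (pi / 2).
Proof.
by rewrite /alpha /= big_ord1 /= !fact0 /= expr0 !mulr1 !invr1 !mulr1 expr1n invr1 !mulr1.
Qed.

Lemma alpha20 : alpha R 2 0 = Num.sqrt (pi / 2) / 2.
Proof.
rewrite /alpha /= !big_ord_recl big_ord0 /= /bump /= !fact0.
rewrite !(factS, fact0, bin0, bin1, binn, muln1, mul1n, addn0, add0n, expr0, expr1, expr1n, invr1).
by rewrite (_ : (1.*2.+1 * 2)%N = 6%N) // (_ : (1 + 1)%N = 2%N) // !expr2; field.
Qed.

Lemma alpha02 : alpha R 0 2 = Num.sqrt (pi / 2) / 2.
Proof.
rewrite -alpha20 /alpha /= addn0 add0n; congr (_ * _ / _ * _).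
  by congr (_ / _); rewrite mulrC.
by apply: eq_bigr => i _; rewrite !addn0.
Qed.

Lemma S2int_beta j w : S2int (fun x y => beta_j b a j w x y / Num.sqrt (Bcoef C b j)) = 0.
Proof.
under [X in S2int X]eq_fun do under eq_fun do rewrite beta_normE.
apply: isS2_S2int; exact: isS2_sum_Yp (hidx_valid j) _.
Qed.

Lemma alpha_odd k l : odd k || odd l -> alpha R k l = 0.
Proof. by rewrite /alpha => ->. Qed.

(** The double sum of [chaos_proj] with arbitrary functions for the field and its two derivatives,
    so that the surviving terms can be isolated before any harmonic enters. *)
Definition chaos_sum (q : nat) z (f g h : R -> R -> R) : R :=
  \sum_(u < q.+1) \sum_(k < u.+1)
    alpha R k (u - k) * betaH (q - u) z / (k`!%:R * (u - k)`!%:R * (q - u)`!%:R) *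
    S2int (fun x y => hermite (q - u) (f x y) * hermite k (g x y) * hermite (u - k) (h x y)).

Lemma big_triangle1 (F : nat -> nat -> R) : F 1%N 0%N = 0 -> F 1%N 1%N = 0 ->
  \sum_(u < 2) \sum_(k < u.+1) F u k = F 0%N 0%N.
Proof. by move=> F10 F11; rewrite !big_ord_recr !big_ord0 /= F10 F11 !add0r !addr0. Qed.

Lemma big_triangle2 (F : nat -> nat -> R) :
  F 1%N 0%N = 0 -> F 1%N 1%N = 0 -> F 2%N 1%N = 0 ->
  \sum_(u < 3) \sum_(k < u.+1) F u k = F 0%N 0%N + (F 2%N 0%N + F 2%N 2%N).
Proof.
move=> F10 F11 F21.
by rewrite !big_ord_recr !big_ord0 /= F10 F11 F21 !add0r !addr0.
Qed.

Definition chaos_term (q : nat) z (f g h : R -> R -> R) (u k : nat) : R :=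
  alpha R k (u - k) * betaH (q - u) z / (k`!%:R * (u - k)`!%:R * (q - u)`!%:R) *
  S2int (fun x y => hermite (q - u) (f x y) * hermite k (g x y) * hermite (u - k) (h x y)).

Lemma chaos_term_odd (q : nat) z f g h u k : odd k || odd (u - k) -> chaos_term q z f g h u k = 0.
Proof. by move=> o; rewrite /chaos_term alpha_odd // !mul0r. Qed.

Lemma chaos_sum1 z f g h :
  chaos_sum 1 z f g h = Num.sqrt (pi / 2) * betaH 1 z * S2int f.
Proof.
rewrite -[chaos_sum _ _ _ _ _]/(\sum_(u < 2) \sum_(k < u.+1) chaos_term 1 z f g h u k).
rewrite big_triangle1; [|exact: chaos_term_odd|exact: chaos_term_odd].
rewrite /chaos_term alpha00 !mul1r invr1 mulr1.
congr (_ * S2int _); apply/funext => x; apply/funext => y.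
by rewrite hermite1E !hermite0E !mulr1.
Qed.

(** The outer [/ 2] is the 1/2! common to the three terms; the inner one is the ratio of [alpha20]
    to [alpha00]. *)
Lemma chaos_sum2 z f g h : chaos_sum 2 z f g h = Num.sqrt (pi / 2) * std_gauss z / 2 *
  ((z ^+ 2 - 1) * S2int (fun x y => hermite 2 (f x y))
   + (S2int (fun x y => hermite 2 (g x y)) + S2int (fun x y => hermite 2 (h x y))) / 2).
Proof.
rewrite -[chaos_sum _ _ _ _ _]/(\sum_(u < 3) \sum_(k < u.+1) chaos_term 2 z f g h u k).
rewrite big_triangle2; [|exact: chaos_term_odd|exact: chaos_term_odd|exact: chaos_term_odd].
have -> : chaos_term 2 z f g h 0 0 = Num.sqrt (pi / 2) * (std_gauss z * (z ^+ 2 - 1)) / 2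
    * S2int (fun x y => hermite 2 (f x y)).
  rewrite /chaos_term alpha00 /betaH hermite2E !mul1r.
  congr (_ / _ * S2int _); apply/funext => x; apply/funext => y.
  by rewrite !hermite0E !mulr1.
have -> : chaos_term 2 z f g h 2 0 = Num.sqrt (pi / 2) / 2 * std_gauss z / 2
    * S2int (fun x y => hermite 2 (h x y)).
  rewrite /chaos_term alpha02 /betaH hermite0E !mulr1 mul1r.
  congr (_ / _ * S2int _); apply/funext => x; apply/funext => y.
  by rewrite !hermite0E !mul1r.
have -> : chaos_term 2 z f g h 2 2 = Num.sqrt (pi / 2) / 2 * std_gauss z / 2
    * S2int (fun x y => hermite 2 (g x y)).
  rewrite /chaos_term alpha20 /betaH hermite0E !mulr1.
  congr (_ / _ * S2int _); apply/funext => x; apply/funext => y.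
  by rewrite !hermite0E mul1r mulr1.
move: (S2int (fun x y => hermite 2 (f x y))) (S2int (fun x y => hermite 2 (g x y)))
  (S2int (fun x y => hermite 2 (h x y))) (Num.sqrt _) (std_gauss z) => If Ig Ih r s.
by field.
Qed.

Lemma chaos_proj1 j z w : chaos_proj C b a j 1 z w = 0.
Proof.
transitivity (Num.sqrt (Acoef C b j) * chaos_sum 1 z
  (fun x y => beta_j b a j w x y / Num.sqrt (Bcoef C b j))
  (fun x y => derive1 (fun t => beta_j b a j w t y / Num.sqrt (Bcoef C b j)) x
      / Num.sqrt (Acoef C b j))
  (fun x y => derive1 (fun s => beta_j b a j w x s / Num.sqrt (Bcoef C b j)) y / sin x
      / Num.sqrt (Acoef C b j))); first by [].
by rewrite chaos_sum1 S2int_beta !mulr0.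
Qed.

Lemma S2int_H2_beta j w :
  S2int (fun x y => hermite 2 (beta_j b a j w x y / Num.sqrt (Bcoef C b j)))
  = \sum_(p <- hidx j) ncoef j w p ^+ 2 - 4 * pi.
Proof.
apply: isS2_S2int.
have := isS2D (isS2_sqr_Yp (uniq_hidx j) (hidx_valid j) (ncoef j w)) (isS2_cst (-1)).
apply: isS2_eq => [x y|]; last by rewrite mulrN1.
by rewrite hermite2E beta_normE.
Qed.

Lemma S2int_H2_th j w : 0 < Acoef C b j ->
  S2int (fun x y => hermite 2 (derive1
     (fun t => beta_j b a j w t y / Num.sqrt (Bcoef C b j)) x / Num.sqrt (Acoef C b j)))
  = Vth (hidx j) (ncoef j w) / Acoef C b j - 4 * pi.
Proof.
move=> A0; apply: isS2_S2int.
have := isS2D (isS2Z (Acoef C b j)^-1 (isS2_sqr_Ythp (hidx j) (ncoef j w))) (isS2_cst (-1)).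
apply: isS2_eq => [x y|]; last by rewrite mulrN1 mulrC.
by rewrite hermite2E derive1_beta_th expr_div_n sqr_sqrtr ?ltW // mulrC.
Qed.

Lemma S2int_H2_ph j w : 0 < Acoef C b j ->
  S2int (fun x y => hermite 2 (derive1
     (fun t => beta_j b a j w x t / Num.sqrt (Bcoef C b j)) y / sin x / Num.sqrt (Acoef C b j)))
  = Vph (hidx j) (ncoef j w) / Acoef C b j - 4 * pi.
Proof.
move=> A0; apply: isS2_S2int.
have := isS2D (isS2Z (Acoef C b j)^-1 (isS2_sqr_Yphp (hidx j) (ncoef j w))) (isS2_cst (-1)).
apply: isS2_eq => [x y|]; last by rewrite mulrN1 mulrC.
by rewrite hermite2E derive1_beta_ph expr_div_n sqr_sqrtr ?ltW // mulrC.
Qed.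

(** The g_l of the overview: [z ^+ 2 - 1] comes from H_2 of the field, and l(l+1)/(2A) from half the
    sum of the two gradient terms. *)
Definition weight2 z j (l : nat) : R := b (l%:R / 2 ^+ j) ^+ 2 / Bcoef C b j *
  (z ^+ 2 - 1 + l%:R * (l%:R + 1) / (2 * Acoef C b j)).

Lemma chaos_proj2 j z w : 0 < Acoef C b j -> 0 < Bcoef C b j ->
  chaos_proj C b a j 2 z w =
  Num.sqrt (Acoef C b j) * Num.sqrt (pi / 2) * std_gauss z / 2 *
  \sum_(p <- hidx j) weight2 z j p.1 * (a p.1 p.2 w ^+ 2 - C p.1).
Proof.
move=> A0 B0.
(* Summing over the 2l+1 orders identifies the area 4 pi of the sphere as the centring constant;
   [SA] does the same for the gradient. *)
have SB : \sum_(p <- hidx j) b (p.1%:R / 2 ^+ j) ^+ 2 * C p.1 = 4 * pi * Bcoef C b j.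
  rewrite (big_hidx1 _ (fun l => b (l%:R / 2 ^+ j) ^+ 2 * C l)) /Bcoef mulr_sumr.
  apply: eq_bigr => l _; have := gt_eqF (pi_gt0 R); move: (pi : R) => w0 w1.
  by field; rewrite w1.
have SA : \sum_(p <- hidx j) b (p.1%:R / 2 ^+ j) ^+ 2 * (p.1%:R * (p.1%:R + 1) / 2) * C p.1
    = 4 * pi * (Bcoef C b j * Acoef C b j).
  rewrite (big_hidx1 _ (fun l => b (l%:R / 2 ^+ j) ^+ 2 * (l%:R * (l%:R + 1) / 2) * C l)).
  rewrite /Acoef mulVKf ?gt_eqF // mulr_sumr.
  apply: eq_bigr => l _; have := gt_eqF (pi_gt0 R); move: (pi : R) => w0 w1.
  by field; rewrite w1.
transitivity (Num.sqrt (Acoef C b j) * chaos_sum 2 z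
  (fun x y => beta_j b a j w x y / Num.sqrt (Bcoef C b j))
  (fun x y => derive1 (fun t => beta_j b a j w t y / Num.sqrt (Bcoef C b j)) x
      / Num.sqrt (Acoef C b j))
  (fun x y => derive1 (fun s => beta_j b a j w x s / Num.sqrt (Bcoef C b j)) y / sin x
      / Num.sqrt (Acoef C b j))); first by [].
rewrite chaos_sum2 S2int_H2_beta S2int_H2_th // S2int_H2_ph //.
rewrite -!mulrA; congr (_ * (_ * (_ * (_ * _)))); congr (_ * _).
set V1 := Vth _ _; set V2 := Vph _ _.
have V12 : V1 + V2 = \sum_(p <- hidx j) p.1%:R * (p.1%:R + 1) * ncoef j w p ^+ 2.
  by rewrite /V1 /V2 Vth_Vph // ?uniq_hidx ?hidx_valid.
have nE p : ncoef j w p ^+ 2 = b (p.1%:R / 2 ^+ j) ^+ 2 / Bcoef C b j * a p.1 p.2 w ^+ 2.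
  by rewrite /ncoef expr_div_n sqr_sqrtr ?ltW //; ring.
have A1 : Acoef C b j != 0 by rewrite gt_eqF.
have B1 : Bcoef C b j != 0 by rewrite gt_eqF.
(* Each constant 4 pi is spread back over the harmonics as a sum of the C_l, so that a_{lm}^2 and
   C_l can be paired term by term. *)
transitivity ((z ^+ 2 - 1) * (\sum_(p <- hidx j) ncoef j w p ^+ 2
    - (Bcoef C b j)^-1 * \sum_(p <- hidx j) b (p.1%:R / 2 ^+ j) ^+ 2 * C p.1)
  + (2 * Acoef C b j)^-1 * (\sum_(p <- hidx j) p.1%:R * (p.1%:R + 1) * ncoef j w p ^+ 2
    - 2 * (Bcoef C b j)^-1 *
      \sum_(p <- hidx j) b (p.1%:R / 2 ^+ j) ^+ 2 * (p.1%:R * (p.1%:R + 1) / 2) * C p.1)).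
  by rewrite SB SA -V12; field; rewrite A1 B1.
rewrite !mulr_sumr -!sumrB !mulr_sumr -big_split /=; apply: eq_bigr => p _.
by rewrite nE /weight2; field; rewrite A1 B1.
Qed.

End ChaosProjections.

(** * Moments of Gaussian variables *)

Section Density.
Context d (T : measurableType d) (R : realType).
Variables (mu nu : {measure set T -> \bar R}) (g : T -> R).
Hypotheses (mg : measurable_fun setT g) (g0 : forall x, 0 <= g x).
Hypothesis nuE : forall A, measurable A -> nu A = (\int[mu]_(x in A) (g x)%:E)%E.

Import HBNNSimple.

(** Simple functions first, where [nuE] applies to each level set; monotone convergence on both
    sides then gives all nonnegative functions. *)
Lemma ge0_integral_density (f : T -> \bar R) : measurable_fun setT f ->
  (forall x, 0 <= f x)%E ->
  (\int[nu]_x f x = \int[mu]_x (f x * (g x)%:E))%E.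
Proof.
move=> mf f0.
pose f_ := nnsfun_approx measurableT mf.
have ndf x m n : (m <= n)%N -> (f_ m x <= f_ n x)%R.
  by move=> mn; exact/lefP/nd_nnsfun_approx.
have cf x : (f_ n x)%:E @[n --> \oo] --> f x.
  by apply: cvg_nnsfun_approx => // ? _; exact: f0.
transitivity (limn (fun n => \int[nu]_x (f_ n x)%:E)%E).
  rewrite -monotone_convergence//.
  - by apply: eq_integral => x _; apply/esym/cvg_lim.
  - by move=> n; exact/measurable_EFinP/measurable_funP.
  - by move=> n y _; rewrite lee_fin.
  - by move=> y _ m n mn; rewrite lee_fin; exact: ndf.
transitivity (limn (fun n => \int[mu]_x ((f_ n x)%:E * (g x)%:E))%E); last first.
  rewrite -monotone_convergence//.
  - apply: eq_integral => x _; apply/cvg_lim => //.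
    by apply: cvgeZr => //; exact: cf.
  - by move=> n; apply: emeasurable_funM; apply/measurable_EFinP.
  - by move=> n y _; rewrite mule_ge0 // lee_fin.
  - move=> y _ m n mn; apply: lee_wpmul2r; first by rewrite lee_fin.
    by rewrite lee_fin; exact: ndf.
congr (limn _); apply/funext => n.
have mk r : measurable (f_ n @^-1` [set r]) by exact: measurable_sfunP.
transitivity (\sum_(k \in range (f_ n)) (k%:E * nu (f_ n @^-1` [set k])))%E.
  under eq_integral do rewrite fimfunE -fsumEFin//.
  rewrite ge0_integral_fsum//; last 2 first.
  - by move=> y; exact/measurable_EFinP/measurable_funM.
  - by move=> y x _; rewrite nnfun_muleindic_ge0.
  by apply: eq_fsbigr => r _; rewrite integralZl_indic_nnsfun// integral_indic//= setIT.
transitivity (\sum_(k \in range (f_ n)) \int[mu]_x (k%:E * ((\1_(f_ n @^-1` [set k]) x)%:E * (g x)%:E)))%E.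
  apply: eq_fsbigr => k /set_mem [x _ fxk].
  rewrite nuE // ge0_integralZl //=.
  - rewrite [in LHS]integral_mkcond; congr (_ * _)%E; apply: eq_integral => y _.
    by rewrite patchE indicE; case: ifP => _ /=; rewrite ?mul1e ?mul0e.
  - by apply: emeasurable_funM; apply/measurable_EFinP => //; exact: measurable_indic.
  - by move=> y _; rewrite mule_ge0 // lee_fin.
  - by rewrite -fxk lee_fin.
rewrite -ge0_integral_fsum //.
- apply: eq_integral => x _.
  rewrite [in RHS](fimfunE (f_ n) x) -fsumEFin // ge0_mule_fsuml.
    by apply: eq_fsbigr => k _; rewrite muleA.
  by move=> k; rewrite nnfun_muleindic_ge0.
- move=> k; apply: emeasurable_funM => //.
  by apply: emeasurable_funM; apply/measurable_EFinP => //; exact: measurable_indic.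
- by move=> k x _; rewrite muleA mule_ge0 ?nnfun_muleindic_ge0 ?lee_fin.
Qed.

End Density.

Section NormalMoments.
Variable R : realType.
Notation mu := (@lebesgue_measure R).
Implicit Types (f h : R -> R) (s x c : R).

Lemma continuous_EFin_measurable f (D : set R) : continuous f ->
  measurable_fun D (EFin \o f).
Proof.
move=> cf; apply/measurable_EFinP; apply: measurable_funTS.
exact: continuous_measurable_fun.
Qed.

(* Integrates [h' = f2 - f1] separately on both sides of its only sign change,
   where it is integrable without further assumption. *)
Lemma ge0_integral_halfline_eq (f1 f2 h : R -> R) c : 0 < c ->
  continuous f1 -> continuous f2 -> (forall x, 0 <= f1 x) -> (forall x, 0 <= f2 x) ->
  (forall x, is_derive x 1 h (f2 x - f1 x)) -> h 0 = 0 -> h x @[x --> +oo] --> 0 ->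
  (forall x, 0 <= x -> x <= c -> f1 x <= f2 x) -> (forall x, c <= x -> f2 x <= f1 x) ->
  (\int[mu]_(x in `[0%R, +oo[) (f1 x)%:E = \int[mu]_(x in `[0%R, +oo[) (f2 x)%:E)%E.
Proof.
move=> c0 c1 c2 f10 f20 dh h0 hy le1 le2.
have ch x : {for x, continuous h}.
  by apply: differentiable_continuous; apply/derivable1_diffP; case: (dh x).
have c12 : continuous (fun x => f2 x - f1 x) by move=> x; apply: cvgB; [exact: c2|exact: c1].
have c21 : continuous (fun x => f1 x - f2 x) by move=> x; apply: cvgB; [exact: c1|exact: c2].
have E1 : (\int[mu]_(x in `[0%R, c]) (f2 x)%:E = (h c)%:E + \int[mu]_(x in `[0%R, c]) (f1 x)%:E)%E.
  transitivity (\int[mu]_(x in `[0%R, c]) ((f2 x - f1 x)%:E + (f1 x)%:E))%E.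
    by apply: eq_integral => x _; rewrite -EFinD subrK.
  rewrite ge0_integralD //.
  - congr (_ + _)%E; rewrite (@continuous_FTC2 _ _ h) //.
    + by rewrite h0 sube0.
    + exact: continuous_subspaceT.
    + split; first by move=> x _; case: (dh x).
      * exact/cvg_at_right_filter/ch.
      * exact/cvg_at_left_filter/ch.
    + by move=> x _; rewrite derive1E; exact: derive_val.
  - move=> x /=; rewrite in_itv /= => /andP[x0 xc].
    by rewrite lee_fin subr_ge0; exact: le1.
  - exact: continuous_EFin_measurable.
  - by move=> x _; rewrite lee_fin.
  - exact: continuous_EFin_measurable.
(* Because [h] tends to 0, the tail contributes the same amount [h c] with the roles of [f1] and
   [f2] exchanged, so the two contributions compensate. *)
have E2 : (\int[mu]_(x in `]c, +oo[) (f1 x)%:E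
    = (h c)%:E + \int[mu]_(x in `]c, +oo[) (f2 x)%:E)%E.
  transitivity (\int[mu]_(x in `]c, +oo[) ((f1 x - f2 x)%:E + (f2 x)%:E))%E.
    by apply: eq_integral => x _; rewrite -EFinD subrK.
  rewrite ge0_integralD //.
  - congr (_ + _)%E; rewrite integral_itv_obnd_cbnd; last exact: continuous_EFin_measurable.
    rewrite (@ge0_continuous_FTC2y _ _ (- h) _ 0).
    + by rewrite sub0e -EFinN opprK.
    + by move=> x cx; rewrite subr_ge0; exact: le2.
    + exact: continuous_subspaceT.
    + by rewrite -oppr0; exact: cvgN.
    + by move=> x _; case: (is_deriveN (dh x)).
    + by apply/cvg_at_right_filter; apply: cvgN; exact: ch.
    + by move=> x _; rewrite derive1E (@derive_val _ _ _ _ _ _ _ (is_deriveN (dh x))) opprB.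
  - move=> x /=; rewrite in_itv /= andbT => /ltW cx.
    by rewrite lee_fin subr_ge0; exact: le2.
  - exact: continuous_EFin_measurable.
  - by move=> x _; rewrite lee_fin.
  - exact: continuous_EFin_measurable.
have U : `[0%R, +oo[%classic = `[0%R, c]%classic `|` `]c, +oo[%classic :> set R.
  by rewrite -itv_bndbnd_setU // bnd_simp // ltW.
have disj : [disjoint `[0%R, c]%classic & `]c, +oo[%classic : set R].
  apply/disj_setPS => x /= []; rewrite !in_itv /= andbT => /andP[_ xc] cx.
  by move: (lt_le_trans cx xc); rewrite ltxx.
rewrite U !ge0_integral_setU //.
- by rewrite E1 E2 addeCA addeA.
- exact: continuous_EFin_measurable.
- by move=> x _; rewrite lee_fin.
- exact: continuous_EFin_measurable.
- by move=> x _; rewrite lee_fin.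
Qed.

Lemma ge0_integral_even_eq (f1 f2 h : R -> R) c : 0 < c ->
  continuous f1 -> continuous f2 -> (forall x, 0 <= f1 x) -> (forall x, 0 <= f2 x) ->
  (forall x, f1 (- x) = f1 x) -> (forall x, f2 (- x) = f2 x) ->
  (forall x, is_derive x 1 h (f2 x - f1 x)) -> h 0 = 0 -> h x @[x --> +oo] --> 0 ->
  (forall x, 0 <= x -> x <= c -> f1 x <= f2 x) -> (forall x, c <= x -> f2 x <= f1 x) ->
  (\int[mu]_x (f1 x)%:E = \int[mu]_x (f2 x)%:E)%E.
Proof.
move=> c0 c1 c2 f10 f20 e1 e2 dh h0 hy le1 le2.
rewrite (ge0_symfun_integralT f10 c1 (fun x => esym (e1 x))).
rewrite (ge0_symfun_integralT f20 c2 (fun x => esym (e2 x))).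
rewrite -set_itvcy.
congr (_ * _)%E; exact: (ge0_integral_halfline_eq c0 c1 c2 f10 f20 dh).
Qed.

Section Moments.
Variables (s : R) (s0 : 0 < s).
Notation phi := (normal_pdf 0 s).

Lemma normal_pdf0E x : phi x = normal_peak s * expR (- (2 * s ^+ 2)^-1 * x ^+ 2).
Proof.
rewrite normal_pdfE ?gt_eqF // /normal_fun subr0; congr (_ * expR _).
by rewrite mulrC -mulr_natl mulrN mulNr.
Qed.

Lemma is_derive_normal_pdf x : is_derive x 1 phi (- x / s ^+ 2 * phi x).
Proof.
have -> : phi = (fun t => normal_peak s * expR (- (2 * s ^+ 2)^-1 * t ^+ 2)).
  by apply/funext => t; rewrite normal_pdf0E.
have d1 : is_derive x 1 (fun t : R => - (2 * s ^+ 2)^-1 * t ^+ 2) (- x / s ^+ 2).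
  have := is_deriveZ (- (2 * s ^+ 2)^-1) (is_deriveX 2 (is_derive_id x (1 : R))).
  have -> : id ^+ 2 = (fun t : R => t ^+ 2) by apply/funext => t; rewrite fctE.
  move=> H; apply: is_derive_eq; rewrite /GRing.scale /= expr1 mulr1.
  by field; rewrite gt_eqF.
have := is_deriveZ (normal_peak s) (@is_derive1_comp R expR _ x _ _ (is_derive_expR _) d1).
by move=> H; apply: is_derive_eq; rewrite /GRing.scale /=; ring.
Qed.

Lemma continuous_Xn_normal_pdf k : continuous (fun x => x ^+ k * phi x).
Proof.
move=> x; apply: cvgM; first exact: exprn_continuous.
by apply: continuous_normal_pdf; rewrite gt_eqF.
Qed.

Lemma normal_pdf_opp x : phi (- x) = phi x.
Proof. by rewrite !normal_pdf0E sqrrN. Qed.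

Lemma cvg_Xn_normal_pdf k : (k < 4)%N -> x ^+ k * phi x @[x --> +oo] --> 0.
Proof.
(* With y = x^2 / (2 s^2), the bound [y ^+ 2 / 2 <= expR y] reads x^4 exp(-y) <= 8 s^4. Hence x^3
   times the density is at most K / x, which decides any [k < 4]. *)
move=> k4; pose K := normal_peak s * (8 * s ^+ 4).
apply: (@squeeze_cvgr _ _ _ _ (cst 0) (fun x => K * x^-1)).
- near=> x; have x1 : 1 <= x by near: x; exact: nbhs_pinfty_ge.
  have x0 : 0 < x by exact: lt_le_trans x1.
  have p0 := normal_pdf_ge0 0 s x.
  rewrite mulr_ge0 ?exprn_ge0 ?(ltW x0) //=.
  apply: (@le_trans _ _ (x ^+ 3 * phi x)).
    by rewrite ler_wpM2r // ler_weXn2l.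
  rewrite normal_pdf0E /K mulrCA -mulrA ler_wpM2l ?normal_peak_ge0 //.
  set y := (2 * s ^+ 2)^-1 * x ^+ 2.
  have y0 : 0 < y by rewrite mulr_gt0 ?invr_gt0 ?mulr_gt0 ?exprn_gt0.
  have : y ^+ 2 / 2 <= expR y.
    by apply: le_trans (expR_ge1Dxn 1 (ltW y0)); rewrite lerDr.
  rewrite mulNr expRN -/y => ey.
  have e0 := expR_gt0 y.
  rewrite ler_pdivlMr // -mulrA mulrCA ler_pdivrMl // .
  rewrite [leLHS](_ : _ = (8 * s ^+ 4) * (y ^+ 2 / 2)); last first.
    by rewrite /y; field; rewrite gt_eqF.
  by rewrite mulrC ler_wpM2r // mulr_ge0 ?exprn_ge0 ?ltW.
- exact: cvg_cst.
- rewrite -(mulr0 K); apply: cvgM; first exact: cvg_cst.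
  apply/(gtr0_cvgV0 (f := id)); last exact: cvg_id.
  by near=> x; near: x; exact: nbhs_pinfty_gt.
Unshelve. all: by end_near. Qed.

Lemma is_derive_Xn_normal_pdf k x : is_derive x 1 (fun t => t ^+ k * phi t)
  (k%:R * x ^+ k.-1 * phi x - x ^+ k.+1 / s ^+ 2 * phi x).
Proof.
have := is_deriveM (is_deriveX k (is_derive_id x (1 : R))) (is_derive_normal_pdf x).
have -> : id ^+ k = (fun t : R => t ^+ k) by apply/funext => t; rewrite fctE.
by move=> H; apply: is_derive_eq; rewrite /GRing.scale /= [x ^+ k.+1]exprS; ring.
Qed.

(** Integration by parts with h = s^2 x^k phi, whose derivative is the difference of the two
    integrands and changes sign on the positive axis at x^2 = k s^2, that is at [c]. Odd [k] makes
    both integrands even and nonnegative. *)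
Lemma integral_normal_pdf_rec k c : 0 < c -> (0 < k < 4)%N -> odd k ->
  c ^+ 2 = k%:R * s ^+ 2 ->
  (\int[mu]_x (x ^+ k.+1 * phi x)%:E
   = (k%:R * s ^+ 2)%:E * \int[mu]_x (x ^+ k.-1 * phi x)%:E)%E.
Proof.
move=> c0 /andP[k0 k4] ok c2.
have ek : ~~ odd k.-1 by case: k k0 ok {k4 c2}.
have ek1 : ~~ odd k.+1 by rewrite /= ok.
have ks0 : 0 <= k%:R * s ^+ 2 by rewrite -c2 sqr_ge0.
have g0 x : 0 <= x ^+ k.-1 * phi x.
  by rewrite mulr_ge0 ?normal_pdf_ge0 // exprn_even_ge0.
have X2 x : x ^+ k.+1 = x ^+ 2 * x ^+ k.-1 by rewrite -exprD add2n prednK.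
rewrite -ge0_integralZl_EFin //; last 2 first.
- by move=> x _; rewrite lee_fin.
- by apply: continuous_EFin_measurable; exact: continuous_Xn_normal_pdf.
under [X in _ = X]eq_integral do rewrite -EFinM.
apply: (@ge0_integral_even_eq _ _ (fun x => s ^+ 2 * (x ^+ k * phi x)) c) => //.
- exact: continuous_Xn_normal_pdf.
- by move=> x; apply: cvgM; [exact: cvg_cst|exact: continuous_Xn_normal_pdf].
- by move=> x; rewrite mulr_ge0 ?normal_pdf_ge0 // exprn_even_ge0.
- by move=> x; rewrite mulr_ge0.
- by move=> x; rewrite normal_pdf_opp exprNn -signr_odd (negbTE ek1) mul1r.
- by move=> x; rewrite normal_pdf_opp exprNn -signr_odd (negbTE ek) mul1r.
- move=> x; have := is_deriveZ (s ^+ 2) (is_derive_Xn_normal_pdf k x).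
  move=> H; apply: is_derive_eq; rewrite /GRing.scale /=.
  by field; rewrite gt_eqF.
- by rewrite expr0n gtn_eqF // mul0r mulr0.
- rewrite -[X in _ --> X](mulr0 (s ^+ 2)); apply: cvgM; [exact: cvg_cst|exact: cvg_Xn_normal_pdf].
- move=> x x0 xc; rewrite X2 -mulrA ler_wpM2r // -c2.
  by rewrite ler_sqr ?nnegrE // ltW.
- move=> x cx; rewrite X2 -mulrA ler_wpM2r // -c2.
  by rewrite ler_sqr ?nnegrE ?(le_trans (ltW c0) cx) // ltW.
Qed.

Lemma integral_sqr_normal_pdf : (\int[mu]_x (x ^+ 2 * phi x)%:E = (s ^+ 2)%:E)%E.
Proof.
rewrite (@integral_normal_pdf_rec 1 s) // ?mul1r //.
under eq_integral do rewrite expr0 mul1r.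
by rewrite integral_normal_pdf mule1.
Qed.

Lemma integral_X4_normal_pdf : (\int[mu]_x (x ^+ 4 * phi x)%:E = (3 * s ^+ 4)%:E)%E.
Proof.
rewrite (@integral_normal_pdf_rec 3 (Num.sqrt 3 * s)) //.
- by rewrite integral_sqr_normal_pdf -EFinM -mulrA -exprD.
- by rewrite mulr_gt0 // sqrtr_gt0.
- by rewrite exprMn sqr_sqrtr.
Qed.

Lemma ge0_integral_normal_prob (f : R -> R) : continuous f -> (forall x, 0 <= f x) ->
  (\int[normal_prob 0 s]_x (f x)%:E = \int[mu]_x (f x * phi x)%:E)%E.
Proof.
move=> cf f0.
rewrite (ge0_integral_density (mu := mu) (g := phi)) //.
- exact: measurable_normal_pdf.
- by move=> x; exact: normal_pdf_ge0.
- exact: continuous_EFin_measurable.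
Qed.

End Moments.
End NormalMoments.

(** * Expectations of squares and products of independent Gaussians *)

Section Expectation.
Context d (T : measurableType d) (R : realType) (P : probability T R).
Implicit Types (f g X Y : T -> R) (v w : R).

(** Integrability travels with the value, so that linear combinations with signs need no further
    justification. *)
Definition has_expectation f v :=
  P.-integrable setT (EFin \o f) /\ (\int[P]_x (f x)%:E = v%:E)%E.

Lemma has_expectationE f v : has_expectation f v -> ('E_P[f] = v%:E)%E.
Proof. by case=> _; rewrite unlock. Qed.

Lemma has_expectation_eq f g v w : (forall x, f x = g x) -> v = w ->
  has_expectation f v -> has_expectation g w.
Proof. by move=> /funext -> ->. Qed.

Lemma has_expectation_ge0 f v : measurable_fun setT f -> (forall x, 0 <= f x) ->
  (\int[P]_x (f x)%:E = v%:E)%E -> has_expectation f v.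
Proof.
move=> mf f0 fv; split=> //; apply/integrableP; split; first exact/measurable_EFinP.
under eq_integral do rewrite /= ger0_norm //.
by rewrite fv ltry.
Qed.

Lemma has_expectation_cst v : has_expectation (fun=> v) v.
Proof.
split; first by apply: finite_measure_integrable_cst.
by have := expectation_cst P v; rewrite unlock.
Qed.

Lemma has_expectationD f g v w : has_expectation f v -> has_expectation g w ->
  has_expectation (fun x => f x + g x) (v + w).
Proof.
move=> [fi fv] [gi gw]; split; first exact: (integrableD measurableT fi gi).
by rewrite (integralD_EFin measurableT fi gi) fv gw.
Qed.

Lemma has_expectationZ c f v : has_expectation f v ->
  has_expectation (fun x => c * f x) (c * v).
Proof.
move=> [fi fv]; split; first exact: (integrableZl measurableT c fi).
under eq_integral do rewrite EFinM.
by rewrite (integralZl measurableT fi) fv.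
Qed.

Lemma has_expectation_sum (I : eqType) (s : seq I) (f : I -> T -> R) (v : I -> R) :
  (forall i, i \in s -> has_expectation (f i) (v i)) ->
  has_expectation (fun x => \sum_(i <- s) f i x) (\sum_(i <- s) v i).
Proof.
elim: s => [|i s IH] H.
  by apply: has_expectation_eq (has_expectation_cst 0) => [x|]; rewrite big_nil.
have Hs : forall j, j \in s -> has_expectation (f j) (v j).
  by move=> j js; apply: H; rewrite inE js orbT.
have Hi : has_expectation (f i) (v i) by apply: H; rewrite inE eqxx.
by apply: has_expectation_eq (has_expectationD Hi (IH Hs)) => [x|]; rewrite big_cons.
Qed.

Section Gaussian.
Variables (X : T -> R) (s : R) (mX : measurable_fun setT X) (s0 : 0 < s).
Hypothesis lawX : forall B : set R, measurable B -> P (X @^-1` B) = normal_prob 0 s B.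

Let Xp : {mfun T >-> measurableTypeR R} :=
  HB.pack X (isMeasurableFun.Build _ _ T (measurableTypeR R) _ mX).

Lemma ge0_integral_gaussian (f : R -> R) : continuous f -> (forall x, 0 <= f x) ->
  (\int[P]_x (f (X x))%:E = \int[normal_prob 0 s]_x (f x)%:E)%E.
Proof.
move=> cf f0.
have := @ge0_integral_pushforward _ _ T (measurableTypeR R) R X mX P setT (EFin \o f) measurableT
  (continuous_EFin_measurable (D := setT) cf).
rewrite preimage_setT => <- //; last by move=> x _; rewrite /= lee_fin.
exact: (@eq_measure_integral _ _ _ setT (normal_prob 0 s) (distribution P Xp) (EFin \o f)
  (fun A mA _ => lawX mA)).
Qed.

Lemma has_expectation_sqr : has_expectation (fun x => X x ^+ 2) (s ^+ 2).
Proof.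
apply: has_expectation_ge0 => [|x|]; [exact: measurable_funX|exact: sqr_ge0|].
rewrite (ge0_integral_gaussian (f := fun t => t ^+ 2)) //; last 2 first.
- exact: exprn_continuous.
- by move=> x; exact: sqr_ge0.
rewrite ge0_integral_normal_prob //; last 2 first.
- exact: exprn_continuous.
- by move=> x; exact: sqr_ge0.
exact: integral_sqr_normal_pdf.
Qed.

Lemma has_expectation_X4 : has_expectation (fun x => X x ^+ 4) (3 * s ^+ 4).
Proof.
have p4 (x : R) : 0 <= x ^+ 4 by exact: exprn_even_ge0.
apply: has_expectation_ge0; [exact: measurable_funX|by []|].
rewrite (ge0_integral_gaussian (f := fun t => t ^+ 4)) //; last exact: exprn_continuous.
rewrite ge0_integral_normal_prob //; last exact: exprn_continuous.
exact: integral_X4_normal_pdf.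
Qed.

End Gaussian.

Section IndependentPair.
Variables (X Y : T -> R) (s t : R).
Hypotheses (mX : measurable_fun setT X) (mY : measurable_fun setT Y) (s0 : 0 < s) (t0 : 0 < t).
Hypothesis lX : forall B : set R, measurable B -> P (X @^-1` B) = normal_prob 0 s B.
Hypothesis lY : forall B : set R, measurable B -> P (Y @^-1` B) = normal_prob 0 t B.
Hypothesis XY : forall A B : set R, measurable A -> measurable B ->
  (P ((X @^-1` A) `&` (Y @^-1` B)) = P (X @^-1` A) * P (Y @^-1` B))%E.

Let XYm x : measurableTypeR R * measurableTypeR R := (X x, Y x).
Let mXY : measurable_fun setT XYm. Proof. exact: measurable_fun_pair. Qed.
Let XYm_mixin := isMeasurableFun.Build _ _ _ _ _ mXY.
Let XYp : {mfun T >-> (measurableTypeR R * measurableTypeR R)%type} := HB.pack XYm XYm_mixin.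

(** Independence says that the joint law agrees with the product of the normal laws on rectangles,
    hence everywhere; Tonelli then separates the factors. *)
Lemma has_expectation_sqr_mul :
  has_expectation (fun x => X x ^+ 2 * Y x ^+ 2) (s ^+ 2 * t ^+ 2).
Proof.
apply: has_expectation_ge0 => [|x|].
- by apply: measurable_funM; exact: measurable_funX.
- by rewrite mulr_ge0 ?sqr_ge0.
pose f (u : measurableTypeR R * measurableTypeR R) :=
  (((u.1 : R) ^+ 2)%:E * ((u.2 : R) ^+ 2)%:E)%E.
have mf : measurable_fun setT f.
  apply: emeasurable_funM; apply/measurable_EFinP; apply: measurable_funX;
    [exact: measurable_fst|exact: measurable_snd].
have f0 u : (0 <= f u)%E by rewrite mule_ge0 // lee_fin sqr_ge0.
have := @ge0_integral_pushforward _ _ T (measurableTypeR R * measurableTypeR R)%type R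
  XYm mXY P setT f measurableT mf.
rewrite preimage_setT => E.
transitivity (\int[pushforward P XYm]_u f u)%E.
  by rewrite E; [apply: eq_integral => x _; rewrite /f /= EFinM|move=> x _; exact: f0].
have mn2 (r : R) (r0 : 0 < r) : (\int[normal_prob 0 r]_x (x ^+ 2)%:E = (r ^+ 2)%:E)%E.
  rewrite ge0_integral_normal_prob //; last 2 first.
  - exact: exprn_continuous.
  - by move=> x; exact: sqr_ge0.
  exact: integral_sqr_normal_pdf.
have msq : measurable_fun setT (fun x : R => (x ^+ 2)%:E).
  by apply: (@continuous_EFin_measurable R (fun x => x ^+ 2)); exact: exprn_continuous.
transitivity (\int[(normal_prob 0 s \x normal_prob 0 t)%E]_u f u)%E.
  rewrite -[pushforward P XYm]/(distribution P XYp).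
  apply: eq_measure_integral => A mA _.
  apply/esym/(@product_measure_unique _ _ _ _ R (normal_prob 0 s) (normal_prob 0 t)) => //.
  by move=> B C mB mC; have := XY mB mC; rewrite (lX mB) (lY mC) => <-.
rewrite fubini_tonelli1 //= /fubini_F /f /=.
have scale (r k : R) : 0 < r -> 0 <= k ->
    (\int[normal_prob 0 r]_y (k%:E * (y ^+ 2)%:E) = k%:E * (r ^+ 2)%:E)%E.
  move=> r0 k0; rewrite ge0_integralZl_EFin //; first by rewrite mn2.
  by move=> y _; rewrite lee_fin sqr_ge0.
transitivity (\int[normal_prob 0 s]_x ((t ^+ 2)%:E * (x ^+ 2)%:E))%E.
  by apply: eq_integral => x _; rewrite scale ?sqr_ge0 // muleC.
by rewrite scale ?sqr_ge0 // -EFinM mulrC.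
Qed.

End IndependentPair.

End Expectation.

(** * Variance of the second chaos *)

Section ChaosVariance.
Context d (T : measurableType d) (R : realType) (P : probability T R).
Variables (C : nat -> R) (a : nat -> int -> T -> R).
Hypothesis C0 : forall l, (0 < l)%N -> 0 < C l.
Hypothesis ma : forall l m, harm_index l m -> measurable_fun setT (a l m).
Hypothesis lawa : forall l m, harm_index l m -> forall B : set R, measurable B ->
  P (a l m @^-1` B) = normal_prob 0 (Num.sqrt (C l)) B.
Hypothesis inda : mutually_independent P harm_index a.
Implicit Types p q : nat * int.

Lemma valid_harm_index p : valid p -> harm_index p.1 p.2.
Proof. by case/andP. Qed.

Lemma pair_independent p q (A B : set R) : valid p -> valid q -> p != q ->
  measurable A -> measurable B ->
  (P ((a p.1 p.2 @^-1` A) `&` (a q.1 q.2 @^-1` B))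
   = P (a p.1 p.2 @^-1` A) * P (a q.1 q.2 @^-1` B))%E.
Proof.
move=> vp vq pq mA mB.
(* The family of sets is indexed by all pairs: [A] at [p] and [B] elsewhere, in particular at [q]
   since [p != q]. *)
have := @inda [:: p; q] (fun r => if r == p then A else B).
rewrite !big_cons big_nil mule1 eqxx eq_sym (negbTE pq) => <- //.
- congr (P _); apply/seteqP; split => w /=.
    move=> [wA wB] r /=; rewrite !inE => /orP[/eqP ->|/eqP ->]; rewrite ?eqxx //.
    by rewrite eq_sym (negbTE pq).
  move=> H; split; first by have := H p; rewrite /= !inE !eqxx; apply.
  by have := H q; rewrite /= !inE eqxx orbT eq_sym (negbTE pq); apply.
- by rewrite /= inE pq.
- by move=> r; rewrite !inE => /orP[] /eqP ->; exact: valid_harm_index.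
- by move=> r; case: ifP.
Qed.

Lemma has_expectation_centered p q : valid p -> valid q ->
  has_expectation P (fun w => (a p.1 p.2 w ^+ 2 - C p.1) * (a q.1 q.2 w ^+ 2 - C q.1))
    (if p == q then 2 * C p.1 ^+ 2 else 0).
Proof.
move=> vp vq; have hp := valid_harm_index vp; have hq := valid_harm_index vq.
have Cp : 0 < C p.1 by apply: C0; case/andP: vp.
have Cq : 0 < C q.1 by apply: C0; case/andP: vq.
have sp : 0 < Num.sqrt (C p.1) by rewrite sqrtr_gt0.
have sq : 0 < Num.sqrt (C q.1) by rewrite sqrtr_gt0.
have Ep := has_expectation_sqr (ma hp) sp (lawa hp).
have Eq := has_expectation_sqr (ma hq) sq (lawa hq).
rewrite sqr_sqrtr ?ltW // in Ep; rewrite sqr_sqrtr ?ltW // in Eq.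
have [E|pq] := eqVneq p q.
  have E4 := has_expectation_X4 (ma hp) sp (lawa hp).
  have := has_expectationD (has_expectationD E4 (has_expectationZ (- (2 * C p.1)) Ep))
    (has_expectation_cst P (C p.1 ^+ 2)).
  apply: has_expectation_eq => [w|]; first by rewrite -E; ring.
  by rewrite (exprM _ 2 2) sqr_sqrtr ?ltW //; ring.
have E2 := has_expectation_sqr_mul (ma hp) (ma hq) sp sq (lawa hp) (lawa hq)
  (fun A B mA mB => pair_independent vp vq pq mA mB).
rewrite !sqr_sqrtr ?ltW // in E2.
have := has_expectationD (has_expectationD (has_expectationD E2
  (has_expectationZ (- C q.1) Ep)) (has_expectationZ (- C p.1) Eq))
    (has_expectation_cst P (C p.1 * C q.1)).
by apply: has_expectation_eq => [w|]; ring.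
Qed.

Lemma has_expectation_sqr_sum (s : seq (nat * int)) (g : nat * int -> R) :
  uniq s -> all valid s ->
  has_expectation P (fun w => (\sum_(p <- s) g p * (a p.1 p.2 w ^+ 2 - C p.1)) ^+ 2)
    (\sum_(p <- s) g p ^+ 2 * (2 * C p.1 ^+ 2)).
Proof.
move=> us vs.
have := @has_expectation_sum _ _ _ P _ s
  (fun p w => \sum_(q <- s) g p * g q *
    ((a p.1 p.2 w ^+ 2 - C p.1) * (a q.1 q.2 w ^+ 2 - C q.1)))
  (fun p => \sum_(q <- s) g p * g q * (if p == q then 2 * C p.1 ^+ 2 else 0)).
move=> H; apply: (has_expectation_eq _ _ (H _)).
- move=> w; rewrite expr2 mulr_suml; apply: eq_bigr => p _.
  by rewrite mulr_sumr; apply: eq_bigr => q _; ring.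
- rewrite sum_diag // => [|p q _ _ /negbTE ->]; last by rewrite mulr0.
  by apply: eq_bigr => p _; rewrite eqxx expr2.
move=> p ps; apply: (@has_expectation_sum _ _ _ P _ s
  (fun q w => g p * g q * ((a p.1 p.2 w ^+ 2 - C p.1) * (a q.1 q.2 w ^+ 2 - C q.1)))) => q qs.
by apply: has_expectationZ; apply: has_expectation_centered; exact: (allP vs).
Qed.

Lemma expectation_chaos_proj2 (b : R -> R) j z :
  0 < Acoef C b j -> 0 < Bcoef C b j ->
  ('E_P[fun w => (chaos_proj C b a j 2 z w ^+ 2)%R] =
   (pi / 4 * std_gauss z ^+ 2 * Acoef C b j *
     \sum_(l <- lwin j) (2 * l%:R + 1) * (weight2 C b z j l ^+ 2 * C l ^+ 2))%:E)%E.
Proof.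
move=> A0 B0; apply: has_expectationE.
(* This scalar is K^2. Together with the factor 2 in the variance of a_{lm}^2 it produces pi / 4. *)
have := has_expectationZ (Acoef C b j * (pi / 2) * (std_gauss z / 2) ^+ 2)
  (has_expectation_sqr_sum (fun p => weight2 C b z j p.1) (uniq_hidx j) (hidx_valid j)).
apply: has_expectation_eq => [w|].
  rewrite chaos_proj2 //; move: (std_gauss z) => u; rewrite [RHS]exprMn !exprMn !exprVn ?sqr_sqrtr ?divr_ge0 ?pi_ge0 ?ltW //.
  by rewrite -!mulrA.
rewrite (big_hidx1 j (fun l => weight2 C b z j l ^+ 2 * (2 * C l ^+ 2))) !mulr_sumr.
by apply: eq_bigr => l _; field.
Qed.

End ChaosVariance.

(** * Riemann sums over dyadic windows *)

Section RiemannSums.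
Variable R : realType.
Notation mu := (@lebesgue_measure R).
Implicit Types (h : R -> R) (e : nat -> R).

(** Based at 0, to the left of the window, so that every point considered is interior and the
    derivative is two-sided. *)
Definition primitive0 h (x : R) : R := \int[mu]_(t in `[0, x]) h t.

Lemma is_derive_primitive0 h (x : R) : continuous h -> 0 < x ->
  is_derive x 1 (primitive0 h) (h x).
Proof.
move=> ch x0; have x1 : x < x + 1 by rewrite ltrDl.
have ih : mu.-integrable `[0, x + 1] (EFin \o h).
  by apply: continuous_compact_integrable; [exact: segment_compact|exact: continuous_subspaceT].
have [dF F'] := continuous_FTC1_closed x1 ih x0 (ch x).
apply: DeriveDef; first exact: dF.
by rewrite -derive1E; exact: F'.
Qed.

Lemma continuous_primitive0 h (x : R) : continuous h -> 0 < x ->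
  {for x, continuous (primitive0 h)}.
Proof.
move=> ch x0; apply: differentiable_continuous; apply/derivable1_diffP.
by case: (is_derive_primitive0 ch x0).
Qed.

Lemma primitive0_MVT h (x y : R) : continuous h -> 0 < x -> x < y ->
  exists2 c, c \in `]x, y[ & primitive0 h y - primitive0 h x = h c * (y - x).
Proof.
move=> ch x0 xy; apply: MVT => //.
  move=> c; rewrite in_itv /= => /andP[xc _].
  by apply: is_derive_primitive0 => //; exact: lt_trans xc.
apply: derivable_within_continuous => c; rewrite in_itv /= => /andP[xc _].
by case: (is_derive_primitive0 ch (lt_le_trans x0 xc)).
Qed.

Lemma Rintegral_primitive0 h (x y : R) : continuous h -> 0 < x -> x < y ->
  \int[mu]_(t in `[x, y]) h t = primitive0 h y - primitive0 h x.
Proof.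
move=> ch x0 xy; rewrite /Rintegral (@continuous_FTC2 _ h (primitive0 h)) //.
- exact: continuous_subspaceT.
- split.
  + move=> c; rewrite in_itv /= => /andP[xc _].
    by case: (is_derive_primitive0 ch (lt_trans x0 xc)).
  + exact/cvg_at_right_filter/continuous_primitive0.
  + by apply/cvg_at_left_filter/continuous_primitive0 => //; exact: lt_trans xy.
- move=> c; rewrite in_itv /= => /andP[xc _].
  have D := is_derive_primitive0 ch (lt_trans x0 xc).
  by rewrite derive1E; exact: derive_val.
Qed.

(** Only [u] is confined to the segment; [v] may lie outside it, as an intermediate point of the
    last subinterval of a Riemann sum may. *)
Lemma uniform_continuous_segment h (x y eps : R) : continuous h -> 0 < eps ->
  exists2 delta, 0 < delta & forall u v, u \in `[x, y] -> `|u - v| < delta ->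
    `|h u - h v| < eps.
Proof.
move=> ch e0.
have /compact_near_coveringP : compact `[x, y]%classic by exact: segment_compact.
move/(_ R (0^'+) (fun d u => forall v, `|u - v| < d -> `|h u - h v| < eps) _).
case.
  move=> u _; have /cvgrPdist_lt /(_ (eps / 2)) : h t @[t --> u] --> h u by exact: ch.
  rewrite divr_gt0 // => /(_ isT) /nbhs_ballP[r /= r0 Hr].
  (* Halving the radius keeps both [w] and any [v] within [r / 2] of [w] inside the ball of radius
     [r] around [u]. *)
  exists (ball u (r / 2), [set d | d < r / 2]) => /=.
    split; first by apply: nbhsx_ballx; rewrite divr_gt0.
    by apply: nbhs_right_lt; rewrite divr_gt0.
  move=> [w d] /= [uw dr] v wv.
  have hw : `|h u - h w| < eps / 2.
    by apply: Hr; apply: le_ball uw; lra.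
  have hv : `|h u - h v| < eps / 2.
    apply: Hr; rewrite /ball /= [X in X < _](_ : _ = `|(u - w) + (w - v)|); last by congr `|_|; ring.
    apply: le_lt_trans (ler_normD _ _) _.
    by rewrite [ltRHS]splitr; apply: ltrD => //; exact: lt_trans dr.
  rewrite [X in X < _](_ : _ = `|(h u - h v) - (h u - h w)|); last by congr `|_|; ring.
  apply: le_lt_trans (ler_normB _ _) _.
  by rewrite [ltRHS]splitr; apply: ltrD.
move=> r /= r0 Hr; exists (r / 2); first by rewrite divr_gt0.
move=> u v uxy uv; apply: (Hr (r / 2)) => //=.
- rewrite /ball /= sub0r normrN gtr0_norm ?divr_gt0 //.
  by rewrite ltr_pdivrMr // ltr_pMr // ltr1n.
- by rewrite divr_gt0.
Qed.

Lemma exp2V_cvg0 : ((2 : R) ^- j) @[j --> \oo] --> (0 : R).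
Proof.
under eq_fun do rewrite -exprVn.
by apply: cvg_expr; rewrite ger0_norm ?invf_lt1 ?ltr1n // invr_ge0.
Qed.

Lemma lwinP (j l : nat) : l \in lwin j -> [/\ (0 < l)%N, (2 ^ j.-1 <= l)%N & (l <= 2 ^ j.+1)%N].
Proof.
rewrite mem_index_iota ltnS => /andP[l1 l2]; split => //.
by apply: leq_trans l1; rewrite expn_gt0.
Qed.

Lemma lwin_scaled j l : l \in lwin j ->
  0 < (l%:R / 2 ^+ j : R) /\ (l%:R / 2 ^+ j : R) \in `[0, 3].
Proof.
case/lwinP => l0 _ l2; have p0 : 0 < 2 ^+ j :> R by rewrite exprn_gt0.
split; first by rewrite divr_gt0 // ltr0n.
rewrite in_itv /=; apply/andP; split; first by rewrite divr_ge0 ?ler0n ?ltW.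
rewrite ler_pdivrMr //.
apply: (@le_trans _ _ (2 * 2 ^+ j)); last first.
  by rewrite ler_wpM2r ?(ltW p0) //; lra.
by rewrite -exprS -natrX ler_nat.
Qed.

(** The window has at most 2^(j+1) + 1 <= 3 * 2^j terms. This is the source of the tolerances
    [eps / 3] below. *)
Lemma lwin_card j (c : R) : 0 <= c -> (2 ^+ j)^-1 * \sum_(l <- lwin j) c <= 3 * c.
Proof.
move=> c0; rewrite big_const_seq count_predT iter_addr_0 size_iota -[c *+ _]mulr_natl mulrA.
rewrite ler_wpM2r // ler_pdivrMl ?exprn_gt0 //.
rewrite -natrX -natrM ler_nat (leq_trans (leq_subr _ _)) //.
by rewrite expnS mulnC ltn_pmul2l // expn_gt0.
Qed.

(** A primitive of [h] telescopes over the window, and by the mean value theorem each increment is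
    2^(-j) times a value of [h] within 2^(-j) of the sample point. *)
Lemma riemann_sum_cvg h : continuous h ->
  (2 ^+ j)^-1 * (\sum_(l <- lwin j) h (l%:R / 2 ^+ j)) @[j --> \oo]
    --> \int[mu]_(x in `[2^-1, 2]) h x.
Proof.
move=> ch; set F := primitive0 h.
have half0 : 0 < 2^-1 :> R by rewrite invr_gt0.
rewrite Rintegral_primitive0 // ?invf_lt1 ?ltr1n //; last first.
  by rewrite (lt_trans (y := 1)) ?invf_lt1 ?ltr1n.
(* The window includes [l = 2 ^ j.+1], so the telescoped sum ends one mesh width beyond 2. *)
have cF2 : F (2 + (2 ^+ j)^-1) @[j --> \oo] --> F 2.
  apply: continuous_cvg; first exact: continuous_primitive0.
  rewrite -[X in _ --> X]addr0; apply: cvgD; [exact: cvg_cst|exact: exp2V_cvg0].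
pose S j := (2 ^+ j)^-1 * \sum_(l <- lwin j) h (l%:R / 2 ^+ j).
suff D0 : S j - (F (2 + (2 ^+ j)^-1) - F 2^-1) @[j --> \oo] --> (0 : R).
  have -> : (fun j => (2 ^+ j)^-1 * \sum_(l <- lwin j) h (l%:R / 2 ^+ j))
      = (fun j => (S j - (F (2 + (2 ^+ j)^-1) - F 2^-1)) + (F (2 + (2 ^+ j)^-1) - F 2^-1)).
    by apply/funext => j; rewrite subrK.
  rewrite -[X in _ --> X]add0r; apply: cvgD D0 _.
  by apply: cvgB cF2 _; exact: cvg_cst.
apply/cvgr0Pnorm_le => eps e0.
have e3 : 0 < eps / 3 by rewrite divr_gt0.
have [delta d0 Hd] := uniform_continuous_segment 0 3 ch e3.
near=> j.
(* For [j = 0] the truncated predecessor would make the window start at 1 instead of 1/2. *)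
have j1 : (0 < j)%N by near: j; exact: nbhs_infty_gt.
have p0 : 0 < 2 ^+ j :> R by rewrite exprn_gt0.
have jd : (2 ^+ j)^-1 < delta.
  near: j; have /cvgrPdist_lt /(_ delta d0) := exp2V_cvg0.
  by apply: filterS => j; rewrite sub0r normrN gtr0_norm // invr_gt0 exprn_gt0.
have tel : F (2 + (2 ^+ j)^-1) - F 2^-1
    = \sum_(l <- lwin j) (F (l.+1%:R / 2 ^+ j) - F (l%:R / 2 ^+ j)).
  rewrite /lwin telescope_sumr; last first.
    by rewrite leqW // leq_exp2l // (leq_trans (leq_pred _)).
  congr (F _ - F _).
    by rewrite -[(2 ^ j.+1).+1%N]addn1 natrD mulrDl mul1r natrX exprS mulfK // gt_eqF.
  rewrite natrX -[in RHS](prednK j1) exprS; field.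
  by rewrite expf_neq0.
rewrite tel /S mulr_sumr -sumrB; apply: le_trans (ler_norm_sum _ _ _) _.
apply: (@le_trans _ _ ((2 ^+ j)^-1 * \sum_(l <- lwin j) eps / 3)); last first.
  by apply: le_trans (lwin_card _ (ltW e3)) _; rewrite mulrC divfK.
rewrite mulr_sumr big_seq [leRHS]big_seq; apply: ler_sum => l ll.
have [x0 x3] := lwin_scaled ll.
have xy : l%:R / 2 ^+ j < l.+1%:R / 2 ^+ j :> R.
  by rewrite ltr_pM2r ?invr_gt0 // ltr_nat.
have [c] := primitive0_MVT ch x0 xy; rewrite in_itv /= => /andP[xc cy] ->.
have yx : l.+1%:R / 2 ^+ j - l%:R / 2 ^+ j = (2 ^+ j)^-1 :> R.
  by rewrite -mulrBl -natrB // subSnn mul1r.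
rewrite yx [_ * h _]mulrC -mulrBl normrM mulrC gtr0_norm ?invr_gt0 //.
rewrite ler_wpM2l ?invr_ge0 ?ltW // Hd //.
rewrite distrC gtr0_norm ?subr_gt0 //; apply: lt_trans jd.
by rewrite -[ltRHS]yx ltrD2r.
Unshelve. all: by end_near. Qed.

Lemma weighted_riemann_sum_cvg h e (L : R) : continuous h -> e n @[n --> \oo] --> L ->
  (2 ^+ j)^-1 * (\sum_(l <- lwin j) h (l%:R / 2 ^+ j) * e l) @[j --> \oo]
    --> L * \int[mu]_(x in `[2^-1, 2]) h x.
Proof.
move=> ch eL.
pose S j := (2 ^+ j)^-1 * \sum_(l <- lwin j) h (l%:R / 2 ^+ j).
suff D0 : (2 ^+ j)^-1 * (\sum_(l <- lwin j) h (l%:R / 2 ^+ j) * e l) - L * S j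
    @[j --> \oo] --> (0 : R).
  have -> : (fun j => (2 ^+ j)^-1 * \sum_(l <- lwin j) h (l%:R / 2 ^+ j) * e l)
      = (fun j => ((2 ^+ j)^-1 * (\sum_(l <- lwin j) h (l%:R / 2 ^+ j) * e l) - L * S j)
                  + L * S j).
    by apply/funext => j; rewrite subrK.
  rewrite -[X in _ --> X]add0r; apply: cvgD D0 _.
  by apply: cvgM; [exact: cvg_cst|exact: riemann_sum_cvg].
have [M M0 HM] : exists2 M, 0 < M & forall x, x \in `[0, 3] -> `|h x| <= M.
  have /compact_bounded[M [_ HM]] : compact (h @` `[0, 3]%classic).
    by apply: continuous_compact; [exact: continuous_subspaceT|exact: segment_compact].
  exists (`|M| + 1); first by rewrite ltr_wpDl.
  move=> x x3; apply: (HM (`|M| + 1)); last by exists x.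
  by rewrite (le_lt_trans (ler_norm _)) // ltrDl.
apply/cvgr0Pnorm_le => eps e0.
have e3 : 0 < eps / (3 * M) by rewrite divr_gt0 // mulr_gt0.
have [n0 _ Hn] : \forall n \near \oo, `|L - e n| <= eps / (3 * M).
  by move/cvgrPdist_le: eL; apply.
near=> j.
(* The smallest degree of the window tends to infinity, so [e l] is close to [L] uniformly over the
   window. *)
have jn : (n0 <= 2 ^ j.-1)%N.
  apply: leq_trans (ltnW (ltn_expl _ (ltnSn 1))); near: j.
  by exists n0.+1 => // j /= nj; rewrite -ltnS (ltn_predK nj).
have p0 : 0 < 2 ^+ j :> R by rewrite exprn_gt0.
rewrite /S mulrCA -mulrBr mulr_sumr -sumrB normrM gtr0_norm ?invr_gt0 //.
apply: (@le_trans _ _ ((2 ^+ j)^-1 * \sum_(l <- lwin j) eps / 3)); last first.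
  have eps3 : 0 <= eps / 3 by rewrite divr_ge0 ?(ltW e0).
  by apply: le_trans (lwin_card _ eps3) _; rewrite mulrC divfK.
rewrite ler_wpM2l ?invr_ge0 ?(ltW p0) //.
apply: le_trans (ler_norm_sum _ _ _) _.
rewrite big_seq [leRHS]big_seq; apply: ler_sum => l ll.
have [x0 x3] := lwin_scaled ll; have [_ l1 _] := lwinP ll.
rewrite mulrC -mulrBl normrM mulrC.
have -> : eps / 3 = M * (eps / (3 * M)) by field; rewrite gt_eqF.
apply: ler_pM => //; first exact: HM.
by rewrite distrC; apply: Hn => /=; exact: leq_trans l1.
Unshelve. all: by end_near. Qed.

(** [h] stays nonzero from [x0] to some [x0 + r / 2], and the support condition then forces this
    point to be at most 2. The primitive is nondecreasing and increases strictly between the two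
    points. *)
Lemma Rintegral_gt0 h (x0 : R) : continuous h -> (forall x, 0 <= h x) ->
  (forall x, h x != 0 -> 2^-1 <= x <= 2) -> h x0 != 0 ->
  0 < \int[mu]_(x in `[2^-1, 2]) h x.
Proof.
move=> ch h0 supp hx0.
have half0 : 0 < 2^-1 :> R by rewrite invr_gt0.
have hp x y : 0 < x -> x <= y -> primitive0 h x <= primitive0 h y.
  rewrite le_eqVlt => x_gt0 /predU1P[->//|xy].
  have [c _ E] := primitive0_MVT ch x_gt0 xy.
  by rewrite -subr_ge0 E mulr_ge0 // subr_ge0 ltW.
have hx0p : 0 < h x0 by rewrite lt_neqAle eq_sym hx0 h0.
have /nbhs_ballP[r /= r0 Hr] : \forall x \near x0, h x != 0.
  have : \forall x \near x0, 0 < h x by exact: (cvgr_gt _ (ch x0) _ hx0p).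
  by apply: filterS => x; rewrite lt_def => /andP[].
have /andP[x01 x02] := supp _ hx0.
have xr : x0 < x0 + r / 2 by rewrite ltrDl divr_gt0.
have ballr y : x0 <= y -> y <= x0 + r / 2 -> h y != 0.
  move=> y1 y2; apply: Hr; rewrite /ball /= distrC ger0_norm ?subr_ge0 //.
  rewrite ltrBlDl (le_lt_trans y2) // ltrD2l ltr_pdivrMr // ltr_pMr // ltr1n.
  by [].
have x0p : 0 < x0 by exact: lt_le_trans x01.
have [c] := primitive0_MVT ch x0p xr; rewrite in_itv /= => /andP[xc cx] E.
have /andP[_ xr2] := supp _ (ballr _ (ltW xr) (lexx _)).
rewrite Rintegral_primitive0 //; last first.
  by rewrite (lt_trans (y := 1)) ?invf_lt1 ?ltr1n.
rewrite subr_gt0; apply: le_lt_trans (hp _ _ half0 x01) _.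
apply: lt_le_trans (hp _ _ (lt_trans x0p xr) xr2).
rewrite -subr_gt0 E mulr_gt0 ?subr_gt0 // lt_neqAle eq_sym h0 andbT.
by apply: ballr; exact: ltW.
Qed.

End RiemannSums.

(** * High-frequency asymptotics *)

Section Asymptotics.
Variables (R : realType) (aexp Glim : R) (Pp Qp : {poly R}) (b : R -> R).
Hypothesis cb : continuous b.
Hypothesis bsupp : forall x, b x != 0 -> 2^-1 <= x <= 2.
Hypothesis b_ge0 : forall x, 0 <= b x.
Hypothesis bneq0 : exists x, b x != 0.
Hypothesis Glim0 : 0 < Glim.
Hypothesis cvgG : (fun n : nat => Pp.[n%:R] / Qp.[n%:R]) @ \oo --> Glim.
Notation mu := (@lebesgue_measure R).
Notation C := (Cl aexp Pp Qp).

(** The exponent of x is split: the real part [c] comes from C_l and is carried as an opaque factor,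
    while the natural part [i] remains accessible to ring computations. *)
Definition window k c i (x : R) : R := b x ^+ k * powR x c * x ^+ i.

(** Below 1/2 the positive power of [b] makes the product vanish locally, so [powR] is only met at
    positive points. *)
Lemma continuous_window k c i : continuous (window k.+1 c i).
Proof.
move=> x; case: (ltP x 2^-1) => hx.
  have nb : \forall y \near x, window k.+1 c i y = 0.
    near=> y; rewrite /window.
    have -> : b y = 0.
      apply/eqP/negPn/negP => /bsupp /andP[+ _]; apply/negP; rewrite -ltNge.
      by near: y; exact: lt_nbhsl.
    by rewrite expr0n /= !mul0r.
  rewrite /continuous_at (nbhs_singleton nb); exact: cvg_near_cst.
have x0 : 0 < x by apply: lt_le_trans hx; rewrite invr_gt0.
apply: cvgM; last exact: exprn_continuous.
apply: cvgM.
  apply: (continuous_comp (f := b) (g := fun t => t ^+ k.+1)); first exact: cb.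
  exact: exprn_continuous.
have cp : {for x, continuous (fun t : R => powR t c)}.
  apply: differentiable_continuous; apply/derivable1_diffP.
  by case: (is_derive1_powR c x0).
exact: cp.
Unshelve. all: by end_near. Qed.

Lemma window_supp k c i x : window k.+1 c i x != 0 -> 2^-1 <= x <= 2.
Proof.
by rewrite /window => H; apply: bsupp; apply: contraNneq H => ->; rewrite expr0n /= !mul0r.
Qed.

Lemma window_ge0 k c i x : 0 <= window k.+1 c i x.
Proof.
have [->//|H] := eqVneq (window k.+1 c i x) 0.
have /andP[x0 _] := window_supp H.
have x0' : 0 <= x by apply: le_trans x0; rewrite invr_ge0.
by rewrite !mulr_ge0 ?exprn_ge0 ?powR_ge0.
Qed.

Lemma window_neq0 k c i x : b x != 0 -> window k c i x != 0.
Proof.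
move=> bx; have /andP[x0 _] := bsupp bx.
have x0' : 0 < x by apply: lt_le_trans x0; rewrite invr_gt0.
by apply: mulf_neq0; [apply: mulf_neq0|]; rewrite ?expf_neq0 // gt_eqF // powR_gt0.
Qed.

Definition Iw k c i : R := \int[mu]_(x in `[2^-1, 2]) window k c i x.

Lemma Iw_gt0 k c i : 0 < Iw k.+1 c i.
Proof.
have [x0 bx0] := bneq0.
apply: (Rintegral_gt0 (x0 := x0)).
- exact: continuous_window.
- by move=> x; exact: window_ge0.
- by move=> x; exact: window_supp.
- exact: window_neq0.
Qed.

Lemma IbE k c (i : nat) : Ib b k (i%:R + c) = Iw k c i.
Proof.
apply: eq_Rintegral => x /set_mem /=; rewrite in_itv /= => /andP[x0 _].
have x0' : 0 < x by apply: lt_le_trans x0; rewrite invr_gt0.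
rewrite /window powRD; last by rewrite (gt_eqF x0') implybT.
by rewrite powR_mulrn ?(ltW x0') // mulrA mulrAC.
Qed.

Lemma invn_cvg0 : (n%:R^-1 : R) @[n --> \oo] --> (0 : R).
Proof.
apply/(gtr0_cvgV0 (f := fun n : nat => n%:R)); last exact: cvgr_idn.
by near=> n; rewrite ltr0n; near: n; exact: nbhs_infty_gt.
Unshelve. all: by end_near. Qed.

Definition ratio (l : nat) : R := Pp.[l%:R] / Qp.[l%:R].
(** [eB], [eA] and [eV] are what remains after the powers of x = l/N are extracted, writing 2l+1 = l
    (2 + 1/l) and l(l+1) = l^2 (1 + 1/l). *)
Definition eB l : R := ratio l * (2 + l%:R^-1) / (4 * pi).
Definition eA l : R := eB l * ((1 + l%:R^-1) / 2).
Definition eV k l : R := (2 + l%:R^-1) * (1 + l%:R^-1) ^+ k * ratio l ^+ 2.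

Lemma eB_cvg : eB n @[n --> \oo] --> Glim / (2 * pi).
Proof.
have -> : Glim / (2 * pi) = Glim * (2 + 0) / (4 * pi).
  have := gt_eqF (pi_gt0 R); move: (pi : R) => w w0.
  by field; rewrite w0.
apply: cvgM; last exact: cvg_cst.
apply: cvgM; first exact: cvgG.
by apply: cvgD; [exact: cvg_cst|exact: invn_cvg0].
Qed.

Lemma eA_cvg : eA n @[n --> \oo] --> Glim / (4 * pi).
Proof.
have -> : Glim / (4 * pi) = Glim / (2 * pi) * ((1 + 0) / 2).
  have := gt_eqF (pi_gt0 R); move: (pi : R) => w w0.
  by field; rewrite w0.
apply: cvgM; first exact: eB_cvg.
apply: cvgM; last exact: cvg_cst.
by apply: cvgD; [exact: cvg_cst|exact: invn_cvg0].
Qed.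

Lemma eV_cvg k : eV k n @[n --> \oo] --> 2 * Glim ^+ 2.
Proof.
have -> : 2 * Glim ^+ 2 = (2 + 0) * (1 + 0) ^+ k * Glim ^+ 2.
  by rewrite !addr0 expr1n mulr1.
have c1 : (n%:R^-1 : R) @[n --> \oo] --> (0 : R) := invn_cvg0.
apply: cvgM; [apply: cvgM|].
- by apply: cvgD; [exact: cvg_cst|exact: c1].
- apply: (cvg_comp _ (fun t : R => t ^+ k)); last exact: exprn_continuous.
  by apply: cvgD; [exact: cvg_cst|exact: c1].
- apply: (cvg_comp _ (fun t : R => t ^+ 2)); last exact: exprn_continuous.
  exact: cvgG.
Qed.

Definition wsum k c i e j : R :=
  (2 ^+ j)^-1 * \sum_(l <- lwin j) window k c i (l%:R / 2 ^+ j) * e l.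

(* [Bhat], [Ahat] and [Vhat] are the rescaled, convergent forms of B, of A * B and of
   the sums of b^4 (2l+1) C_l^2 (l (l+1))^k. *)
Definition Bhat := wsum 2 (- aexp) 1 eB.
Definition Ahat := wsum 2 (- aexp) 3 eA.
Definition Vhat k := wsum 4 (- aexp * 2) (k.*2.+1) (eV k).

Lemma Bhat_cvg : Bhat j @[j --> \oo] --> Glim / (2 * pi) * Iw 2 (- aexp) 1.
Proof. exact: weighted_riemann_sum_cvg (@continuous_window _ _ _) eB_cvg. Qed.

Lemma Ahat_cvg : Ahat j @[j --> \oo] --> Glim / (4 * pi) * Iw 2 (- aexp) 3.
Proof. exact: weighted_riemann_sum_cvg (@continuous_window _ _ _) eA_cvg. Qed.

Lemma Vhat_cvg k : Vhat k j @[j --> \oo] --> 2 * Glim ^+ 2 * Iw 4 (- aexp * 2) k.*2.+1.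
Proof. exact: weighted_riemann_sum_cvg (@continuous_window _ _ _) (eV_cvg k). Qed.

Definition nu j : R := powR (2 ^+ j) (- aexp).

Lemma nu_gt0 j : 0 < nu j.
Proof. by rewrite powR_gt0 // exprn_gt0. Qed.

Lemma Cl_lwin j l : l \in lwin j ->
  C l = nu j * powR (l%:R / 2 ^+ j) (- aexp) * ratio l.
Proof.
move=> ll; have [x0 _] := lwin_scaled R ll.
rewrite /Cl -/(ratio l); congr (_ * _).
have p0 : 0 < 2 ^+ j :> R by rewrite exprn_gt0.
by rewrite /nu -powRM ?(ltW x0) ?(ltW p0) // mulrCA divff ?mulr1 // gt_eqF.
Qed.

Lemma big_wsum k c i e j (F : nat -> R) (K : R) :
  (forall l, l \in lwin j -> F l = K * (window k c i (l%:R / 2 ^+ j) * e l)) ->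
  \sum_(l <- lwin j) F l = K * 2 ^+ j * wsum k c i e j.
Proof.
move=> H; rewrite /wsum -mulrA mulVKf ?expf_neq0 // mulr_sumr big_seq [RHS]big_seq.
exact: eq_bigr.
Qed.

Lemma lwin_neq0 j l : l \in lwin j -> l%:R != 0 :> R.
Proof. by case/lwinP => l0 _ _; rewrite pnatr_eq0 -lt0n. Qed.

Lemma pi_neq0 : (pi : R) != 0.
Proof. by rewrite gt_eqF // pi_gt0. Qed.

Lemma exp2_neq0 j : 2 ^+ j != 0 :> R.
Proof. by rewrite expf_neq0. Qed.

Lemma BcoefE j : Bcoef C b j = nu j * (2 ^+ j) ^+ 2 * Bhat j.
Proof.
rewrite /Bcoef (@big_wsum 2 (- aexp) 1 eB j _ (nu j * 2 ^+ j)).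
  by rewrite expr2 mulrA.
move=> l ll; rewrite (Cl_lwin ll) /window /eB.
have l0 := lwin_neq0 ll; have w0 := pi_neq0; have p0 := exp2_neq0 j.
set y := powR _ _; set u := b _; set r := ratio l; set n := nu j.
move: (2 ^+ j) p0 (pi : R) w0 (l%:R : R) l0 y u r n => p p0 w w0 x x0 y u r n.
by field; rewrite x0 p0 w0.
Qed.

Lemma AcoefE j : 0 < Bhat j -> Acoef C b j = (2 ^+ j) ^+ 2 * Ahat j / Bhat j.
Proof.
move=> Bh; have p0 := exp2_neq0 j.
have n0 : nu j != 0 by rewrite gt_eqF // nu_gt0.
rewrite /Acoef BcoefE (@big_wsum 2 (- aexp) 3 eA j _ (nu j * (2 ^+ j) ^+ 3)).
  rewrite -/(Ahat j); move: (2 ^+ j) p0 (nu j) n0 => p p0 n n0.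
  by field; rewrite n0 p0 gt_eqF.
move=> l ll; rewrite (Cl_lwin ll) /window /eA /eB.
have l0 := lwin_neq0 ll; have w0 := pi_neq0.
set y := powR _ _; set u := b _; set r := ratio l; set n := nu j.
move: (2 ^+ j) p0 (pi : R) w0 (l%:R : R) l0 y u r n => p p0' w w0 x x0 y u r n.
by field; rewrite x0 p0' w0.
Qed.

(** The three terms are those of the expanded square of z^2 - 1 + l(l+1)/(2A). The N^(2k) in
    (l(l+1))^k is absorbed by A^(-k), so the same power of N is left in all of them. *)
Lemma variance_sumE j z : 0 < Bhat j -> 0 < Ahat j ->
  \sum_(l <- lwin j) (2 * l%:R + 1) * (weight2 C b z j l ^+ 2 * C l ^+ 2)
  = ((z ^+ 2 - 1) ^+ 2 * Vhat 0 j
     + (z ^+ 2 - 1) * Bhat j / Ahat j * Vhat 1 j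
     + (Bhat j / (2 * Ahat j)) ^+ 2 * Vhat 2 j) / ((2 ^+ j) ^+ 2 * Bhat j ^+ 2).
Proof.
move=> Bh Ah; have p0 := exp2_neq0 j.
have n0 : nu j != 0 by rewrite gt_eqF // nu_gt0.
have B0 : Bhat j != 0 by rewrite gt_eqF.
have A0 : Ahat j != 0 by rewrite gt_eqF.
pose K := 2 ^+ j * nu j ^+ 2 / Bcoef C b j ^+ 2.
pose F k l := K * (window 4 (- aexp * 2) k.*2.+1 (l%:R / 2 ^+ j) * eV k l).
transitivity (\sum_(l <- lwin j) ((z ^+ 2 - 1) ^+ 2 * F 0%N l
     + (z ^+ 2 - 1) * Bhat j / Ahat j * F 1%N l + (Bhat j / (2 * Ahat j)) ^+ 2 * F 2%N l)).
  rewrite big_seq [RHS]big_seq; apply: eq_bigr => l ll.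
  rewrite (Cl_lwin ll) /F /K /weight2 AcoefE // BcoefE /window /eV.
  have -> : powR (l%:R / 2 ^+ j) (- aexp * 2) = powR (l%:R / 2 ^+ j) (- aexp) ^+ 2.
    by rewrite powRrM -powR_mulrn ?powR_ge0.
  have l0 := lwin_neq0 ll.
  set y := powR _ _; set u := b _; set r := ratio l.
  move: (2 ^+ j) p0 (nu j) n0 (Bhat j) B0 (Ahat j) A0 (l%:R : R) l0 y u r.
  move=> p p0' n n0' B B0' A A0' x x0 y u r.
  by field; rewrite x0 p0' n0' B0' A0'.
have SF k : \sum_(l <- lwin j) F k l = K * 2 ^+ j * Vhat k j by exact: big_wsum.
transitivity ((z ^+ 2 - 1) ^+ 2 * (\sum_(l <- lwin j) F 0%N l)
     + (z ^+ 2 - 1) * Bhat j / Ahat j * (\sum_(l <- lwin j) F 1%N l)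
     + (Bhat j / (2 * Ahat j)) ^+ 2 * (\sum_(l <- lwin j) F 2%N l)).
  by rewrite !big_split /= !mulr_sumr.
rewrite !SF /K BcoefE.
move: (2 ^+ j) p0 (nu j) n0 (Bhat j) B0 (Ahat j) A0 => p p0' n n0' B B0' A A0'.
by field; rewrite p0' n0' B0' A0'.
Qed.

Lemma MaE : Ma b aexp = Iw 2 (- aexp) 3 / Iw 2 (- aexp) 1.
Proof. by rewrite /Ma (IbE 2 (- aexp) 3) -[1 - aexp]/(1%:R - aexp) IbE. Qed.

Lemma Ma_gt0 : 0 < Ma b aexp.
Proof. by rewrite MaE divr_gt0 ?Iw_gt0. Qed.

Definition limit_window z (x : R) : R :=
  window 4 (- aexp * 2) 1 x * (x ^+ 2 / Ma b aexp + z ^+ 2 - 1) ^+ 2.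

Lemma limit_windowE z (x : R) : limit_window z x =
  (z ^+ 2 - 1) ^+ 2 * window 4 (- aexp * 2) 1 x
  + (2 * (z ^+ 2 - 1) / Ma b aexp * window 4 (- aexp * 2) 3 x
  + (Ma b aexp)^-1 ^+ 2 * window 4 (- aexp * 2) 5 x).
Proof. by rewrite /limit_window /window; ring. Qed.

Lemma limit_window_integral z :
  \int[mu]_(x in `[2^-1, 2]) (b x ^+ 4 * powR x (1 - 2 * aexp) *
     (x ^+ 2 / Ma b aexp + z ^+ 2 - 1) ^+ 2) = \int[mu]_(x in `[2^-1, 2]) limit_window z x.
Proof.
apply: eq_Rintegral => x /set_mem /=; rewrite in_itv /= => /andP[x0 _].
have x0' : 0 < x by apply: lt_le_trans x0; rewrite invr_gt0.
rewrite /limit_window /window powRD; last by rewrite (gt_eqF x0') implybT.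
by rewrite powRr1 ?(ltW x0') // [2 * _]mulrC -mulNr; ring.
Qed.

Lemma integrable_window k c i r : mu.-integrable `[2^-1, 2] (EFin \o (fun x => r * window k.+1 c i x)).
Proof.
apply: continuous_compact_integrable; first exact: segment_compact.
apply: continuous_subspaceT => x.
by apply: cvgM; [exact: cvg_cst|exact: continuous_window].
Qed.

Lemma integral_limit_window z : \int[mu]_(x in `[2^-1, 2]) limit_window z x =
  (z ^+ 2 - 1) ^+ 2 * Iw 4 (- aexp * 2) 1
  + (2 * (z ^+ 2 - 1) / Ma b aexp * Iw 4 (- aexp * 2) 3
  + (Ma b aexp)^-1 ^+ 2 * Iw 4 (- aexp * 2) 5).
Proof.
have iw1 k c i : mu.-integrable `[2^-1, 2] (EFin \o window k.+1 c i).
  by apply: continuous_compact_integrable;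
    [exact: segment_compact|exact/continuous_subspaceT/continuous_window].
under eq_Rintegral do rewrite limit_windowE.
rewrite RintegralD //; last 2 first.
- exact: integrable_window.
- apply: (integrableD _ (integrable_window _ _ _ _) (integrable_window _ _ _ _)) => //.
rewrite RintegralD //; last 2 first.
- exact: integrable_window.
- exact: integrable_window.
by rewrite !RintegralZl.
Qed.

Lemma integral_limit_window_gt0 z : 0 < \int[mu]_(x in `[2^-1, 2]) limit_window z x.
Proof.
have cl : continuous (limit_window z).
  move=> x; apply: cvgM; first exact: continuous_window.
  apply: (cvg_comp _ (fun t : R => t ^+ 2)); last exact: exprn_continuous.
  apply: cvgB; last exact: cvg_cst.
  apply: cvgD; last exact: cvg_cst.
  by apply: cvgM; [exact: exprn_continuous|exact: cvg_cst].
have l0 x : 0 <= limit_window z x by rewrite mulr_ge0 ?window_ge0 ?sqr_ge0.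
have ls x : limit_window z x != 0 -> 2^-1 <= x <= 2.
  by rewrite mulf_eq0 negb_or => /andP[/window_supp].
suff [x0 Hx0] : exists x, limit_window z x != 0 by exact: Rintegral_gt0 cl l0 ls Hx0.
have good x : b x != 0 -> x ^+ 2 / Ma b aexp + z ^+ 2 - 1 != 0 -> limit_window z x != 0.
  by move=> bx H; rewrite mulf_neq0 ?expf_neq0 ?window_neq0.
have [x0 bx0] := bneq0.
(* If the quadratic factor vanishes at [x0], a small move to the right makes it positive while [b]
   remains positive. *)
have [E|] := eqVneq (x0 ^+ 2 / Ma b aexp + z ^+ 2 - 1) 0; last by exists x0; exact: good.
have bx0p : 0 < b x0 by rewrite lt_neqAle eq_sym bx0 b_ge0.
have nb : \forall x \near x0, 0 < b x by exact: (cvgr_gt _ (@cb x0) _ bx0p).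
have /nbhs_ballP[r /= r0 Hr] := nb.
have bx1 : 0 < b (x0 + r / 2).
  apply: Hr; rewrite /ball /= opprD addNKr normrN gtr0_norm ?divr_gt0 //; lra.
have x0p : 0 < x0.
  by have /andP[H _] := bsupp bx0; apply: lt_le_trans H; rewrite invr_gt0.
exists (x0 + r / 2); apply: good; first by rewrite gt_eqF.
have -> : (x0 + r / 2) ^+ 2 / Ma b aexp + z ^+ 2 - 1
    = (x0 ^+ 2 / Ma b aexp + z ^+ 2 - 1) + (x0 * r + r ^+ 2 / 4) / Ma b aexp.
  by field; rewrite gt_eqF // Ma_gt0.
rewrite E add0r gt_eqF // divr_gt0 ?Ma_gt0 // addr_gt0 ?mulr_gt0 // ?divr_gt0 ?exprn_gt0 //.
Qed.

Lemma std_gauss_gt0 (z : R) : 0 < std_gauss z.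
Proof. by rewrite divr_gt0 ?expR_gt0 // sqrtr_gt0 mulr_gt0 // pi_gt0. Qed.

Lemma limit_constE z : limit_const b aexp z =
  pi ^+ 3 * std_gauss z ^+ 2 * Ma b aexp / (Iw 2 (- aexp) 1) ^+ 2 *
  \int[mu]_(x in `[2^-1, 2]) limit_window z x.
Proof.
by rewrite /limit_const limit_window_integral -[1 - aexp]/(1%:R - aexp) IbE.
Qed.

Lemma limit_const_neq0 z : limit_const b aexp z != 0.
Proof.
rewrite limit_constE gt_eqF // mulr_gt0 ?integral_limit_window_gt0 //.
rewrite divr_gt0 ?exprn_gt0 ?Iw_gt0 //.
by rewrite mulr_gt0 ?Ma_gt0 // mulr_gt0 ?exprn_gt0 ?pi_gt0 ?std_gauss_gt0.
Qed.

Lemma Bhat_gt0 : \forall j \near \oo, 0 < Bhat j.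
Proof.
by apply: (cvgr_gt _ Bhat_cvg); rewrite mulr_gt0 ?Iw_gt0 // divr_gt0 // mulr_gt0 // pi_gt0.
Qed.

Lemma Ahat_gt0 : \forall j \near \oo, 0 < Ahat j.
Proof.
by apply: (cvgr_gt _ Ahat_cvg); rewrite mulr_gt0 ?Iw_gt0 // divr_gt0 // mulr_gt0 // pi_gt0.
Qed.

(** The second moment after cancellation of the powers of N: N^2 from A against N^(-2) from
    [variance_sumE]. *)
Definition variance_hat z j : R := pi / 4 * std_gauss z ^+ 2 * (Ahat j / Bhat j ^+ 3) *
  ((z ^+ 2 - 1) ^+ 2 * Vhat 0 j + (z ^+ 2 - 1) * Bhat j / Ahat j * Vhat 1 j
   + (Bhat j / (2 * Ahat j)) ^+ 2 * Vhat 2 j).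

Lemma variance_hat_cvg z : variance_hat z j @[j --> \oo] --> limit_const b aexp z.
Proof.
have I1 := Iw_gt0 1 (- aexp) 1; have I3 := Iw_gt0 1 (- aexp) 3.
have p0 := pi_gt0 R.
have B0 : Glim / (2 * pi) * Iw 2 (- aexp) 1 != 0.
  by rewrite gt_eqF // mulr_gt0 // divr_gt0 // mulr_gt0.
have A0 : Glim / (4 * pi) * Iw 2 (- aexp) 3 != 0.
  by rewrite gt_eqF // mulr_gt0 // divr_gt0 // mulr_gt0.
have BA : Bhat j / Ahat j @[j --> \oo] --> Glim / (2 * pi) * Iw 2 (- aexp) 1
    / (Glim / (4 * pi) * Iw 2 (- aexp) 3).
  by apply: cvgM; [exact: Bhat_cvg|exact: cvgV A0 Ahat_cvg].
(* [Glim] cancels with exponents 1 - 3 + 2, and Bhat / Ahat tends to 2 / M_a. The constant is (pi /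
   4) * (1 / (4 pi)) * (2 pi)^3 * 2 = pi^3. *)
have -> : limit_const b aexp z = pi / 4 * std_gauss z ^+ 2 *
    (Glim / (4 * pi) * Iw 2 (- aexp) 3 / (Glim / (2 * pi) * Iw 2 (- aexp) 1) ^+ 3) *
  ((z ^+ 2 - 1) ^+ 2 * (2 * Glim ^+ 2 * Iw 4 (- aexp * 2) 1)
   + (z ^+ 2 - 1) * (Glim / (2 * pi) * Iw 2 (- aexp) 1 / (Glim / (4 * pi) * Iw 2 (- aexp) 3))
       * (2 * Glim ^+ 2 * Iw 4 (- aexp * 2) 3)
   + (Glim / (2 * pi) * Iw 2 (- aexp) 1 / (Glim / (4 * pi) * Iw 2 (- aexp) 3) / 2) ^+ 2
       * (2 * Glim ^+ 2 * Iw 4 (- aexp * 2) 5)).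
  rewrite limit_constE integral_limit_window MaE.
  have g0 : Glim != 0 by rewrite gt_eqF.
  move: (pi : R) (lt0r_neq0 p0) (Iw 2 (- aexp) 1) (lt0r_neq0 I1) (Iw 2 (- aexp) 3)
    (lt0r_neq0 I3) (std_gauss z) => w w0 i1 i10 i3 i30 f.
  by field; rewrite ?w0 ?i10 ?i30 ?g0.
have pow n (u : nat -> R) (l : R) : u j @[j --> \oo] --> l -> u j ^+ n @[j --> \oo] --> l ^+ n.
  by move=> ul; apply: (cvg_comp _ (fun t : R => t ^+ n)) ul _; exact: exprn_continuous.
have V0 : Vhat 0 j @[j --> \oo] --> 2 * Glim ^+ 2 * Iw 4 (- aexp * 2) 1 := @Vhat_cvg 0.
have V1 : Vhat 1 j @[j --> \oo] --> 2 * Glim ^+ 2 * Iw 4 (- aexp * 2) 3 := @Vhat_cvg 1.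
have V2 : Vhat 2 j @[j --> \oo] --> 2 * Glim ^+ 2 * Iw 4 (- aexp * 2) 5 := @Vhat_cvg 2.
rewrite /variance_hat; apply: cvgM.
  apply: cvgM; first exact: cvg_cst.
  apply: cvgM; first exact: Ahat_cvg.
  by apply: cvgV; [rewrite expf_neq0|exact: pow Bhat_cvg].
apply: cvgD; [apply: cvgD|].
- by apply: cvgM; [exact: cvg_cst|exact: V0].
- apply: cvgM; last exact: V1.
  under eq_fun do rewrite -mulrA.
  by apply: cvgM; [exact: cvg_cst|exact: BA].
- apply: cvgM; last exact: V2.
  apply: pow; under eq_fun do rewrite invfM mulrCA mulrC.
  by apply: cvgM; [exact: BA|exact: cvg_cst].
Qed.

(** Positivity of A and B is read off from the positive limits of [Ahat] and [Bhat], hence the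
    restriction to large [j]. *)
Lemma chaos_varianceE z : \forall j \near \oo,
  [/\ 0 < Acoef C b j, 0 < Bcoef C b j &
  pi / 4 * std_gauss z ^+ 2 * Acoef C b j *
     \sum_(l <- lwin j) (2 * l%:R + 1) * (weight2 C b z j l ^+ 2 * C l ^+ 2)
  = variance_hat z j].
Proof.
near=> j.
have Bh : 0 < Bhat j by near: j; exact: Bhat_gt0.
have Ah : 0 < Ahat j by near: j; exact: Ahat_gt0.
have p0 : 0 < 2 ^+ j :> R by rewrite exprn_gt0.
split.
- by rewrite AcoefE // divr_gt0 // mulr_gt0 // exprn_gt0.
- by rewrite BcoefE mulr_gt0 // mulr_gt0 ?nu_gt0 // exprn_gt0.
rewrite variance_sumE // AcoefE // /variance_hat.
set S := (_ + _ * Vhat 1 j + _).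
move: S (2 ^+ j) (lt0r_neq0 p0) (Bhat j) (lt0r_neq0 Bh) (Ahat j) (std_gauss z) => S p p0' B B0 A f.
by field; rewrite p0' B0.
Unshelve. all: by end_near. Qed.

End Asymptotics.

Theorem mainTheorem5 (R : realType) (d : measure_display) (T : measurableType d)
    (P : probability T R) (aexp : R) (Pp Qp : {poly R}) (b : R -> R)
    (a : nat -> int -> T -> R) (Glim : R) (z : R) :
  (* Model Assumption *)
  4 < aexp ->
  size Pp = size Qp ->
  (forall l : nat, (1 <= l)%N -> 0 < Pp.[l%:R] /\ 0 < Qp.[l%:R]) ->
  (fun n : nat => Pp.[n%:R] / Qp.[n%:R]) @ \oo --> Glim -> 0 < Glim ->
  (* the window function b *)
  smooth b ->
  (forall x, 0 <= b x) ->
  (forall x, b x != 0 -> 2^-1 <= x <= 2) ->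
  (forall l : nat, (2 < l)%N ->
     (fun n : nat => \sum_(0 <= j < n) b (l%:R / 2 ^+ j) ^+ 2) @ \oo --> (1 : R)) ->
  (* the coefficients a_{lm}: independent centered Gaussians of variance C_l *)
  (forall l m, harm_index l m -> measurable_fun setT (a l m)) ->
  (forall l m, harm_index l m -> forall B : set R, measurable B ->
     P (a l m @^-1` B) = normal_prob 0 (Num.sqrt (Cl aexp Pp Qp l)) B) ->
  mutually_independent P harm_index a ->
  (forall j : nat,
     ('E_P[fun w => (chaos_proj (Cl aexp Pp Qp) b a j 1 z w ^+ 2)%R] = 0)%E) /\
  ((fun j : nat => ('E_P[fun w => (chaos_proj (Cl aexp Pp Qp) b a j 2 z w ^+ 2)%R])%E)
     @ \oo --> (limit_const b aexp z)%:E) /\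
  limit_const b aexp z != 0.
Proof.
move=> _ _ PQ0 cvgG Glim0 smb b_ge0 bsupp bsum ma lawa inda.
have cb : continuous b.
  move=> x; apply: differentiable_continuous; apply/derivable1_diffP.
  exact: (smb 0%N x).
(* Were [b] identically zero, the partition of unity at [l = 3] would have sum 0 instead of 1. *)
have bneq0 : exists x, b x != 0.
  apply/not_existsP => b0.
  have E : (fun n : nat => \sum_(0 <= j < n) b (3%:R / 2 ^+ j) ^+ 2) = (fun=> 0).
    apply/funext => n; apply: big1 => j _.
    by have /negP/negPn/eqP -> := b0 (3%:R / 2 ^+ j); rewrite expr0n.
  have := bsum 3%N isT; rewrite E => /(cvg_lim (@Rhausdorff R)).
  by rewrite lim_cst //; apply/eqP; rewrite eq_sym oner_eq0.
have C0 l : (0 < l)%N -> 0 < Cl aexp Pp Qp l.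
  move=> l0; have [P0 Q0] := PQ0 l l0.
  by rewrite mulr_gt0 ?divr_gt0 // powR_gt0 // ltr0n.
split; last split.
- move=> j; rewrite (_ : (fun w => _) = cst 0); first exact: expectation_cst.
  by apply/funext => w; rewrite chaos_proj1 expr0n.
- have hv : variance_hat aexp Pp Qp b z j @[j --> \oo] --> limit_const b aexp z.
    by apply: (variance_hat_cvg (Glim := Glim)).
  apply: (@cvg_trans _ ((variance_hat aexp Pp Qp b z j)%:E @[j --> \oo])); last first.
    by apply: cvg_EFin; [exact: nearW|exact: hv].
  apply: near_eq_cvg.
  have := chaos_varianceE aexp cb bsupp b_ge0 bneq0 Glim0 cvgG z.
  apply: filterS => j [A0 B0 <-].
  by rewrite (expectation_chaos_proj2 C0 ma lawa inda).
- exact: limit_const_neq0.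
Qed.
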